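(* Let $\Omega\subset\mathbb{R}^n$ be a John domain and let $\rho\colon\Omega\to(0,\infty)$ be a density such that $\rho>c$ on $\Omega$ for some constant $c>0$. Suppose that the limit \[ i(x)=\lim_{y\in\Omega,\ y\to x}\frac{\log\rho(y)}{\log d(y)} \] (taken with respect to the internal metric $d$) exists at all points $x\in\partial\Omega_d$ and satisfies $i(x)>-1$. Then \[ \dim_\rho(\partial_\rho\Omega)=\sup_{\beta>-1}(1+\beta)^{-1}\dim_d\bigl(\{x\in\partial\Omega_d : i(x)\le\beta\}\bigr), \] and analogously for the packing dimension, \[ \operatorname{Dim}_\rho(\partial_\rho\Omega)=\sup_{\beta>-1}(1+\beta)^{-1}\operatorname{Dim}_d\bigl(\{x\in\partial\Omega_d : i(x)\le\beta\}\bigr). \]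
   Context: Internal metric. For a domain $\Omega\subset\mathbb{R}^n$ and $x,y\in\Omega$, $d(x,y)=\inf_\gamma\ell(\gamma)$, the infimum over all rectifiable curves $\gamma$ in $\Omega$ joining $x$ and $y$, where $\ell$ is Euclidean length. $\overline{\Omega}_d$ is the metric completion of $(\Omega,d)$ and $\partial\Omega_d=\overline{\Omega}_d\setminus\Omega$ is the internal boundary; $d$ is extended to $\overline{\Omega}_d$. For $A\subset\overline\Omega_d$, $d(x,A)=\inf_{a\in A}d(x,a)$, and $d(x)=d(x,\partial\Omega_d)$ (the Euclidean distance from $x$ to the boundary of $\Omega$). $\rho$-metric. For a continuous $\rho\colon\Omega\to(0,\infty)$ and a rectifiable curve $\gamma$, $\ell_\rho(\gamma)=\int_\gamma\rho(z)|dz|$ (integration with respect to arclength), and $d_\rho(x,y)=\inf_\gamma\ell_\rho(\gamma)$, the infimum over all rectifiable curves joining $x$ to $y$ in $\Omega$. $\overline\Omega_\rho$ is the metric completion of $(\Omega,d_\rho)$ and $\partial_\rho\Omega=\overline\Omega_\rho\setminus\Omega$. Density. A density on $\Omega$ is a continuous function $\rho\colon\Omega\to(0,\infty)$ with $\partial_\rho\Omega\ne\emptyset$ such that for all sequences $(x_i)$ in $\Omega$: (A1) if $(x_i)$ converges in $\overline\Omega_\rho$, then it converges in $\overline\Omega_d$; (A2) if $(x_i)$ converges in $\overline\Omega_d$, then it has at most one accumulation point in $\partial_\rho\Omega$. Equivalently, the identity map $(\Omega,d_\rho)\to(\Omega,d)$ extends to a continuous injective map $\overline\Omega_\rho\to\overline\Omega_d$;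 via this map $\overline\Omega_\rho$ is identified with a subset of $\overline\Omega_d$, and $\partial_\rho\Omega$ with a subset of $\partial\Omega_d$. Curves are rectifiable, arc-length parametrized, with $\gamma(t)\in\Omega$ for $0<t<\ell(\gamma)$ (endpoints may lie in $\partial\Omega_d$). For $0<\alpha\le1$, $\Omega$ is an $\alpha$-John domain if there is $x_0\in\Omega$ such that every $x\in\Omega$ can be joined to $x_0$ by a curve $\gamma$ starting at $x$ with $d(\gamma(t))\ge\alpha t$ for all $0\le t\le\ell(\gamma)$. A John domain is an $\alpha$-John domain for some $\alpha$. Dimensions. For a separable metric space $(X,d_X)$ and $A\subset X$, $\dim_X(A)$ is the usual Hausdorff dimension. The packing dimension $\operatorname{Dim}_X(A)=\inf\{s\ge0:\mathcal P^s_X(A)=0\}$ is defined from $P^{s,\varepsilon}_X(A)=\sup\{\sum_i r_i^s\}$, the supremum over disjoint families of balls $B_X(x_i,r_i)$ with $x_i\in A$, $r_i\le\varepsilon$; $P^s_X(A)=\lim_{\varepsilon\downarrow0}P^{s,\varepsilon}_X(A)$; $\mathcal P^s_X(A)=\inf\{\sum_i P^s_X(A_i): A\subset\bigcup_i A_i\}$ (countable covers). Conventions: $\sup\emptyset=0$, $\inf\emptyset=\infty$. $\dim_d,\operatorname{Dim}_d$ denote these dimensions with respect to $d$, and $\dim_\rho,\operatorname{Dim}_\rho$ with respect to $d_\rho$. *)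

(* Defs.v *)
From HB Require Import structures.
From mathcomp Require Import all_boot all_order all_algebra.
From mathcomp Require Import all_classical all_reals all_analysis.

Set Implicit Arguments.
Unset Strict Implicit.
Unset Printing Implicit Defensive.

Import Order.TTheory GRing.Theory Num.Theory.
Import numFieldNormedType.Exports.

Local Open Scope classical_set_scope.
Local Open Scope ring_scope.

Section completion.
Context {R : realType} {T : Type}.

(* A metric completion of the subset D of T for the distance d.  It is unique
   up to a unique isometry fixing D, so a statement about the completion is
   stated for an arbitrary one.  The map embed is only meaningful on D. *)
Record completion (D : set T) (d : T -> T -> \bar R) := Completion {
  carrier :> metricType R ;
  embed : T -> carrier ;
  embed_isometry : forall x y, D x -> D y ->
    (mdist (embed x) (embed y))%:E = d x y ;
  embed_dense : dense (embed @` D) ;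
  carrier_complete : forall F : set_system carrier,
    ProperFilter F -> cauchy F -> exists p : carrier, F --> p }.

Definition ideal_boundary D d (X : completion D d) : set X :=
  ~` (@embed D d X @` D).

Definition approach D d (X : completion D d) (p : X) : set_system T :=
  filter_from (nbhs p) (fun U => D `&` @embed D d X @^-1` U).

End completion.

Arguments embed {R T D d} _ _.
Arguments ideal_boundary {R T D d} X.
Arguments approach {R T D d} X p.

Section curves.
Context {R : realType} {n : nat}.
Implicit Types (Omega : set 'rV[R]_n) (rho : 'rV[R]_n -> R).

(* The library norm on 'rV[R]_n is the sup norm; it gives the same topology
   but not the same lengths. *)
Definition euclid_norm (v : 'rV[R]_n) : R := Num.sqrt (\sum_i v ord0 i ^+ 2).

Definition polygon_length (a b : R) (g : R -> 'rV[R]_n) (s : seq R) : R :=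
  let G := g \o nth b (a :: s) in
  \sum_(0 <= k < size s) euclid_norm (G k.+1 - G k).

Definition curve_length (a b : R) (g : R -> 'rV[R]_n) : \bar R :=
  ereal_sup [set (polygon_length a b g s)%:E | s in itv_partition a b].

(* A rectifiable curve in Omega of length L from x to y, parametrized by
   arc length on [0, L]; it is 1-Lipschitz there, hence continuous. *)
Definition is_curve Omega (x y : 'rV[R]_n) (L : R) (g : R -> 'rV[R]_n) : Prop :=
  [/\ 0 <= L, g 0 = x, g L = y,
      (forall t, 0 <= t <= L -> Omega (g t)) &
      forall s t, 0 <= s -> s <= t -> t <= L ->
        curve_length s t g = (t - s)%:E].

Definition inner_dist Omega (x y : 'rV[R]_n) : \bar R :=
  ereal_inf [set l | exists L g, is_curve Omega x y L g /\ l = L%:E].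

Definition rho_length rho (L : R) (g : R -> 'rV[R]_n) : \bar R :=
  (\int[lebesgue_measure]_(t in `[0%R, L]) (rho (g t))%:E)%E.

Definition rho_dist Omega rho (x y : 'rV[R]_n) : \bar R :=
  ereal_inf [set l | exists L g,
    is_curve Omega x y L g /\ l = rho_length rho L g].

Definition domain Omega : Prop :=
  [/\ open Omega, connected Omega & Omega !=set0].

(* ereal_inf of the empty set is +oo, as required when there is no boundary. *)
Definition boundary_dist Omega (X : completion Omega (inner_dist Omega))
    (x : 'rV[R]_n) : \bar R :=
  ereal_inf [set (mdist (embed X x) a)%:E | a in ideal_boundary X].

Definition alpha_john Omega (X : completion Omega (inner_dist Omega))
    (alpha : R) : Prop :=
  exists2 x0, Omega x0 & forall x, Omega x -> exists L g,
    is_curve Omega x x0 L g /\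
    forall t, 0 <= t <= L -> ((alpha * t)%:E <= boundary_dist X (g t))%E.

Definition john_domain Omega (X : completion Omega (inner_dist Omega)) : Prop :=
  domain Omega /\ exists2 alpha, 0 < alpha <= 1 & alpha_john X alpha.

Definition density Omega rho (Xd : completion Omega (inner_dist Omega))
    (Xr : completion Omega (rho_dist Omega rho)) : Prop :=
  [/\ {within Omega, continuous rho},
      (forall x, Omega x -> 0 < rho x),
      ideal_boundary Xr !=set0,
      (forall u : nat -> 'rV[R]_n, (forall k, Omega (u k)) ->
        (exists p : Xr, embed Xr (u k) @[k --> \oo] --> p) ->
        exists q : Xd, embed Xd (u k) @[k --> \oo] --> q) &
      forall u : nat -> 'rV[R]_n, (forall k, Omega (u k)) ->
        (exists q : Xd, embed Xd (u k) @[k --> \oo] --> q) ->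
        forall p1 p2 : Xr, ideal_boundary Xr p1 -> ideal_boundary Xr p2 ->
          cluster (embed Xr (u k) @[k --> \oo]) p1 ->
          cluster (embed Xr (u k) @[k --> \oo]) p2 -> p1 = p2].

End curves.

Section dimensions.
Context {R : realType} {X : metricType R}.
Implicit Types (A : set X) (s e : R).
Local Open Scope ereal_scope.

Definition diam A : \bar R :=
  ereal_sup [set (mdist p.1 p.2)%:E | p in A `*` A].

(* The empty set has weight 0 also for s = 0, where 0 `^ 0 = 1. *)
Definition diam_pow s A : \bar R :=
  if A == set0 then 0 else poweR (diam A) s.

Definition hausdorff_content s e A : \bar R :=
  ereal_inf [set \sum_(0 <= k <oo) diam_pow s (U k) | U in
    [set U : nat -> set X |
      A `<=` \bigcup_k U k /\ forall k, diam (U k) <= e%:E]].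

Definition hausdorff_measure s A : \bar R :=
  lim (hausdorff_content s e A @[e --> 0%R^'+]).

Definition hausdorff_dim A : \bar R :=
  ereal_inf [set s%:E | s in [set s | (0 <= s)%R /\ hausdorff_measure s A = 0]].

(* A family of balls is a set of pairs (centre, radius); balls are open, which
   gives the same packing dimension as closed ones. *)
Definition packing e A : set (set (X * R)) :=
  [set F | (forall p, F p -> A p.1 /\ (0 < p.2 <= e)%R) /\
           trivIset F (fun p => ball p.1 p.2)].

Definition packing_content s e A : \bar R :=
  ereal_sup [set \esum_(p in F) (p.2 `^ s)%:E | F in packing e A].

Definition packing_premeasure s A : \bar R :=
  lim (packing_content s e A @[e --> 0%R^'+]).

Definition packing_measure s A : \bar R :=
  ereal_inf [set \sum_(0 <= k <oo) packing_premeasure s (U k) | U in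
    [set U : nat -> set X | A `<=` \bigcup_k U k]].

Definition packing_dim A : \bar R :=
  ereal_inf [set s%:E | s in [set s | (0 <= s)%R /\ packing_measure s A = 0]].

End dimensions.

(* Main.v *)
(* Near a boundary point x, the identification of the two boundaries is bi-
   Hoelder with exponent 1 + i(x), up to an arbitrarily small loss. Since rho
   > c forces i <= 0, a curve of length r starting near x has rho-length at
   least of order r^(1+b) when rho >= delta^b near x, because delta <= 2r on
   its initial piece. Conversely, let rho <= delta^a near x with a > -1.
   Points at internal distance r of x flow along their John curves, at rho-
   cost of order r^(1+a), to points whose distance to the boundary is of order
   r. By a volume count a bounded number of balls covers the latter, so that
   moving along a curve of length r one cannot go further than a constant
   times r^(1+a) in the rho-metric. Splitting the boundary into countably many
   pieces on which these two estimates hold uniformly, both dimensions are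
   multiplied on each piece by 1 / (1 + i). *)

Require Import Defs.
From mathcomp Require Import all_boot all_order all_algebra.
From mathcomp Require Import all_classical all_reals all_analysis.
From mathcomp Require Import measurable_realfun ring lra.

Set Implicit Arguments.
Unset Strict Implicit.
Unset Printing Implicit Defensive.

Import Order.TTheory GRing.Theory Num.Theory.
Import numFieldNormedType.Exports.

Local Open Scope classical_set_scope.
Local Open Scope ring_scope.

(** * Covers, null sets and dimensions *)

(** Packings shape the estimates. Their balls live in the whole completion, so a Hölder bound
    between points of one piece of the boundary says nothing about disjointness. The sets
    [upper_regular] and [lower_regular] therefore ask for regularity at one point [x] only; the
    bounds then hold between [x] and every nearby point of the completion, interior points included.
    Two balls that meet share a point of [Omega], and this point lies in the corresponding balls of
    the other metric. The identification of the boundaries is the relation [corresponding], common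
    approximation from [Omega]. The bound [rho > c] makes it a map from the rho-completion to the
    internal one; the upper estimate makes this map a bijection between the boundaries. Dimensions
    enter only through their null sets: these grow with the exponent, are stable under subsets and
    countable unions, and are carried along with the exponent multiplied by [q] on pieces of
    exponent [q]. The formula is derived once, from these properties alone, for both dimensions. *)

Section countable_covers.
Context {R : realType} {T : Type}.
Variables (phi : set T -> \bar R) (Q : set T -> Prop).
Hypothesis phi_ge0 : forall U, (0 <= phi U)%E.
Local Open Scope ereal_scope.

(** Common form of the Hausdorff contents, where [Q] bounds the diameter, and of the packing
    measure, where [Q] is trivial. *)
Definition cover_content (A : set T) : \bar R :=
  ereal_inf [set \sum_(0 <= k <oo) phi (U k) | U in
    [set U : nat -> set T | A `<=` \bigcup_k U k /\ forall k, Q (U k)]].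

Lemma cover_content_ge0 A : 0 <= cover_content A.
Proof. by apply: le_ereal_inf_tmp => _ [U _ <-]; exact: nneseries_ge0. Qed.

Lemma le_cover_content A B : A `<=` B -> cover_content A <= cover_content B.
Proof.
move=> AB; apply: ereal_inf_le_tmp => _ [U [BU QU] <-]; exists U => //.
by split => //; exact: subset_trans BU.
Qed.

(** The k-th set gets a cover of total weight at most e / 2^(k+1); a bijection of [nat] with its
    square enumerates all the covers together. *)
Lemma cover_content_bigcup (F : nat -> set T) :
  (forall k, cover_content (F k) = 0) -> cover_content (\bigcup_k F k) = 0.
Proof.
move=> F0; apply/eqP; rewrite eq_le cover_content_ge0 andbT.
apply/lee_addgt0Pr => e e0; rewrite add0e.
have [G FG] : {G : nat -> nat -> set T & forall k,
    (F k `<=` \bigcup_j G k j /\ forall j, Q (G k j)) /\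
    \sum_(0 <= j <oo) phi (G k j) <= (e / (2 ^ k.+1)%:R)%:E}.
  apply: (@choice _ _ (fun k U => (F k `<=` \bigcup_j U j /\
    forall j, Q (U j)) /\ \sum_(0 <= j <oo) phi (U j) <= _)) => k.
  have : cover_content (F k) < (e / (2 ^ k.+1)%:R)%:E.
    by rewrite F0 lte_fin divr_gt0// ltr0n expn_gt0.
  by move=> /ereal_inf_lt[_ [U FU <-] /ltW]; exists U.
have /card_esym/ppcard_eqP[f] := card_nat2.
apply: ge_ereal_inf; exists (\sum_(0 <= k <oo) phi (G (f k).1 (f k).2)).
  exists (fun k => G (f k).1 (f k).2) => //; split => [x [k _ Fx]|k].
    have [j _ Gx] := (FG k).1.1 x Fx.
    by exists (f^-1%FUN (k, j)) => //; rewrite invK ?inE.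
  exact: (FG _).1.2.
rewrite nneseries_esumT//.
rewrite -(reindex_esum setT setT f (fun p => phi (G p.1 p.2)))//.
rewrite (_ : setT = setT `*`` (fun=> setT)); last exact/seteqP.
rewrite -(@esum_esum _ _ _ _ _ (fun i j => phi (G i j)))//.
apply: (@le_trans _ _ (\sum_(0 <= k <oo) (e / (2 ^ k.+1)%:R)%:E)); last first.
  exact/epsilon_trick0/ltW.
rewrite nneseries_esumT; last first.
  by move=> k; rewrite lee_fin divr_ge0// ltW.
by apply: le_esum => k _; rewrite -nneseries_esumT//; exact: (FG k).2.
Qed.

End countable_covers.

Section covers_transfer.
Context {R : realType} {T T' : Type}.
Local Open Scope ereal_scope.

Lemma cover_content_transfer (phi : set T -> \bar R) (Q : set T -> Prop)
    (phi' : set T' -> \bar R) (Q' : set T' -> Prop) (G : set T -> set T')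
    (C : R) (A : set T) (B : set T') :
  (0 <= C)%R -> (forall U, 0 <= phi U) -> (forall U, 0 <= phi' U) ->
  (forall U, Q U -> Q' (G U) /\ phi' (G U) <= C%:E * phi U) ->
  (forall U : nat -> set T,
    A `<=` \bigcup_k U k -> B `<=` \bigcup_k G (U k)) ->
  cover_content phi Q A = 0 -> cover_content phi' Q' B = 0.
Proof.
move=> C0 phi0 phi'0 QG AB A0; apply/eqP.
rewrite eq_le cover_content_ge0// andbT.
apply/lee_addgt0Pr => e e0; rewrite add0e.
(* [C] may vanish, so the error is divided by [C + 1]. *)
have C1 : (0 < C + 1)%R by rewrite ltr_wpDl.
have : cover_content phi Q A < (e / (C + 1))%:E.
  by rewrite A0 lte_fin divr_gt0.
move=> /ereal_inf_lt[_ [U [AU QU] <-] Ue].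
apply: ge_ereal_inf; exists (\sum_(0 <= k <oo) phi' (G (U k))).
  exists (fun k => G (U k)) => //; split; first exact: AB.
  by move=> k; have [] := QG _ (QU k).
apply: (@le_trans _ _ (\sum_(0 <= k <oo) (C%:E * phi (U k)))).
  by apply: lee_nneseries => // k _; have [] := QG _ (QU k).
rewrite nneseriesZl//; apply: (@le_trans _ _ (C%:E * (e / (C + 1))%:E)).
  by rewrite lee_wpmul2l// ltW.
rewrite -EFinM lee_fin mulrCA ler_piMr ?ltW// ltr_pdivrMr// mul1r ltrDl.
by [].
Qed.

End covers_transfer.

(** * Hausdorff null sets and their Hölder images *)

Section hausdorff.
Context {R : realType} {X : metricType R}.
Implicit Types (A B U : set X) (s t e : R).
Local Open Scope ereal_scope.

Lemma diam_pow_ge0 s U : 0 <= diam_pow s U.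
Proof. by rewrite /diam_pow; case: ifP => // _; exact: poweR_ge0. Qed.

Lemma diam_ge0 U : U !=set0 -> 0 <= diam U.
Proof.
move=> [x Ux]; apply: ereal_sup_ubound; exists (x, x) => //=.
by rewrite mdistxx.
Qed.

Lemma hausdorff_contentE s e A : hausdorff_content s e A =
  cover_content (diam_pow s) (fun U => diam U <= e%:E) A.
Proof. by []. Qed.

(** The content decreases as [e] grows, so its limit at 0 is a supremum. *)
Lemma hausdorff_measure_eq0 s A : hausdorff_measure s A = 0 <->
  forall e, (0 < e)%R -> hausdorff_content s e A = 0.
Proof.
have c0 e : 0 <= hausdorff_content s e A.
  by rewrite hausdorff_contentE cover_content_ge0// => U; exact: diam_pow_ge0.
have -> : hausdorff_measure s A =
    ereal_sup ((hausdorff_content s ^~ A) @` [set` `]0%R, +oo[]).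
  apply: cvg_lim => //; apply: nonincreasing_at_right_cvge => //.
  move=> a b _ _ ab; apply: ereal_inf_le_tmp => _ [U [AU Ub] <-].
  exists U => //; split => // k; apply: le_trans (Ub k) _.
  by rewrite lee_fin.
split=> [A0 e e0|A0].
  apply/eqP; rewrite eq_le c0 andbT -A0; apply: ereal_sup_ubound.
  by exists e => //=; rewrite in_itv/= e0.
apply/eqP; rewrite eq_le; apply/andP; split.
  apply: ge_ereal_sup => _ [e ep <-]; rewrite A0//.
  by move: ep; rewrite /= in_itv/= andbT.
apply: le_ereal_sup_tmp; exists 0 => //; exists 1%R; last exact: A0.
by rewrite /= in_itv/= ltr01.
Qed.

Lemma sub_hausdorff_eq0 s A B :
  A `<=` B -> hausdorff_measure s B = 0 -> hausdorff_measure s A = 0.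
Proof.
move=> AB /hausdorff_measure_eq0 B0; apply/hausdorff_measure_eq0 => e e0.
rewrite hausdorff_contentE; apply/eqP.
rewrite eq_le cover_content_ge0 ?andbT; last by move=> U; exact: diam_pow_ge0.
by rewrite -(B0 _ e0) hausdorff_contentE le_cover_content.
Qed.

Lemma bigcup_hausdorff_eq0 s (F : nat -> set X) :
  (forall k, hausdorff_measure s (F k) = 0) ->
  hausdorff_measure s (\bigcup_k F k) = 0.
Proof.
move=> F0; apply/hausdorff_measure_eq0 => e e0.
rewrite hausdorff_contentE cover_content_bigcup//.
  by move=> U; exact: diam_pow_ge0.
by move=> k; have /hausdorff_measure_eq0/(_ e e0) := F0 k.
Qed.

Lemma hausdorff_eq0_le s t A : (0 <= s <= t)%R ->
  hausdorff_measure s A = 0 -> hausdorff_measure t A = 0.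
Proof.
move=> /andP[s0 st] /hausdorff_measure_eq0 A0.
apply/hausdorff_measure_eq0 => e e0.
(* For diameters at most 1, a larger exponent gives a smaller power. *)
have m0 : (0 < Num.min e 1)%R by rewrite lt_min e0/= ltr01.
move: (A0 _ m0); rewrite !hausdorff_contentE.
apply: (@cover_content_transfer _ _ _ _ _ _ _ id 1%R) => //.
- by move=> U; exact: diam_pow_ge0.
- by move=> U; exact: diam_pow_ge0.
move=> U /=; rewrite EFin_min le_min => /andP[Ue U1]; split=> //.
rewrite mul1e /diam_pow; case: ifPn => // /set0P/diam_ge0.
move: U1; case: (diam U) => //= d; rewrite !lee_fin => d1 d0.
(* Zero to the power zero is 1, so a singleton has weight 1 at exponent 0; but [t = 0] forces
   [s = 0]. *)
have [->|d_neq0] := eqVneq d 0%R; last first.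
  by apply: ger_powR; rewrite // d1 andbT lt_neqAle eq_sym d_neq0.
have [t0|t_neq0] := eqVneq t 0%R; last by rewrite powR0// powR_ge0.
by rewrite (_ : s = t)//; apply/eqP; rewrite eq_le st t0 s0.
Qed.

End hausdorff.

Section hausdorff_image.
Context {R : realType} {T : Type} {X Y : metricType R}.
Variables (phi : T -> X) (psi : T -> Y) (A : set T) (C kappa delta : R).
Hypotheses (C0 : 0 < C) (kappa0 : 0 < kappa) (delta0 : 0 < delta).

(* [T] indexes matching points of the two spaces, so that the lemma applies in
   both directions without inverting a map. *)
Hypothesis holder : forall x z, A x -> A z -> mdist (phi x) (phi z) <= delta ->
  mdist (psi x) (psi z) <= C * mdist (phi x) (phi z) `^ kappa.

Lemma hausdorff_eq0_image s : 0 < s ->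
  hausdorff_measure (kappa * s) (phi @` A) = 0%E ->
  hausdorff_measure s (psi @` A) = 0%E.
Proof.
move=> s0 /hausdorff_measure_eq0 A0; apply/hausdorff_measure_eq0 => e e0.
have eC0 : 0 < e / C by rewrite divr_gt0.
(* The bound [holder] holds up to [delta], and a diameter at most (e / C)^(1/kappa) becomes one at
   most [e]. *)
pose e' := Num.min delta ((e / C) `^ kappa^-1).
have e'0 : 0 < e' by rewrite lt_min delta0/= powR_gt0.
move: (A0 _ e'0); rewrite !hausdorff_contentE.
apply: (@cover_content_transfer _ _ _ _ _ _ _
  (fun U => psi @` (A `&` phi @^-1` U)) (C `^ s)).
- exact: powR_ge0.
- by move=> U; exact: diam_pow_ge0.
- by move=> U; exact: diam_pow_ge0.
- move=> U Ue'.
  (* An empty piece has diameter -oo and weight 0, so real diameters are only available in the other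
     case. *)
  have [UA0|/set0P[y Ay]] := eqVneq (psi @` (A `&` phi @^-1` U)) set0.
    rewrite UA0; split.
      by apply: ge_ereal_sup => _ [p [[]]].
    by rewrite /diam_pow eqxx mule_ge0// ?lee_fin ?powR_ge0// diam_pow_ge0.
  have U0 : U !=set0 by case: Ay => x [_ Ux] _; exists (phi x).
  move: (diam_ge0 U0) Ue'; case dU : (diam U) => [d||]//.
  rewrite !lee_fin => d0 de'.
  have dV : (diam (psi @` (A `&` phi @^-1` U)) <= (C * d `^ kappa)%:E)%E.
    apply: ge_ereal_sup => _ [p [[x [Ax Ux] xp] [z [Az Uz] zp]] <-].
    have xzd : mdist (phi x) (phi z) <= d.
      by rewrite -lee_fin -dU; apply: ereal_sup_ubound; exists (phi x, phi z).
    rewrite -xp -zp lee_fin; apply: (le_trans (holder Ax Az _)).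
      by rewrite (le_trans xzd)// (le_trans de')// ge_min lexx.
    rewrite ler_pM2l//; apply: ge0_ler_powR; rewrite ?nnegrE ?mdist_ge0//.
    exact: ltW.
  split.
    apply: (le_trans dV); rewrite lee_fin mulrC -ler_pdivlMr//.
    have -> : e / C = ((e / C) `^ kappa^-1) `^ kappa.
      by rewrite -powRrM mulVf ?gt_eqF// powRr1// ltW.
    apply: ge0_ler_powR; rewrite ?nnegrE ?powR_ge0//; first exact: ltW.
    by rewrite (le_trans de')// ge_min lexx orbT.
  rewrite /diam_pow ifF; last by apply/negbTE/set0P; exists y.
  rewrite ifF; last exact/negbTE/set0P.
  rewrite dU poweR_EFin powRrM -EFinM -powRM ?powR_ge0//; last exact: ltW.
  move: dV (@diam_ge0 _ _ (psi @` (A `&` phi @^-1` U)) (ex_intro _ y Ay)).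
  case: (diam _) => [v||]//; rewrite !lee_fin => vC v0.
  apply: ge0_ler_powR; rewrite ?nnegrE//; first exact: ltW.
  by rewrite mulr_ge0 ?powR_ge0// ltW.
- move=> U AU _ [x Ax <-].
  by have [k _ Ux] := AU _ (imageP _ Ax); exists k => //; exists x.
Qed.

End hausdorff_image.

(** * Packing null sets and their images *)

Section packing.
Context {R : realType} {X : metricType R}.
Implicit Types (A B U : set X) (s t e : R).
Local Open Scope ereal_scope.

Lemma packing_content_ge0 s e A : 0 <= packing_content s e A.
Proof.
apply: ereal_sup_ubound; exists set0; last by rewrite esum_set0.
by split=> // p q [].
Qed.

Lemma le_packing_content s e e' A : (e <= e')%R ->
  packing_content s e A <= packing_content s e' A.
Proof.
move=> ee'; apply: ereal_sup_le => _ [F [FA tF] <-]; exists F => //.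
split=> // p /FA[Ap /andP[p0 pe]]; split=> //.
by rewrite p0 (le_trans pe).
Qed.

(** Smaller radii leave fewer packings, so the limit at 0 is an infimum. *)
Lemma packing_premeasureE s A : packing_premeasure s A =
  ereal_inf ((packing_content s ^~ A) @` [set` `]0%R, +oo[]).
Proof.
apply: cvg_lim => //; apply: nondecreasing_at_right_cvge => //.
by move=> a b _ _; exact: le_packing_content.
Qed.

Lemma packing_premeasure_ge0 s A : 0 <= packing_premeasure s A.
Proof.
rewrite packing_premeasureE; apply: le_ereal_inf_tmp => _ [e _ <-].
exact: packing_content_ge0.
Qed.

Lemma packing_premeasure_le s e A : (0 < e)%R ->
  packing_premeasure s A <= packing_content s e A.
Proof.
move=> e0; rewrite packing_premeasureE; apply: ereal_inf_lbound.
by exists e => //=; rewrite in_itv/= e0.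
Qed.

Lemma le_packing_premeasure s A (x : \bar R) (e : R) : (0 < e)%R ->
  (forall e', (0 < e' <= e)%R -> x <= packing_content s e' A) ->
  x <= packing_premeasure s A.
Proof.
move=> e0 xA; rewrite packing_premeasureE.
apply: le_ereal_inf_tmp => _ [e'' e''0 <-].
apply: (@le_trans _ _ (packing_content s (Num.min e'' e) A)).
  apply: xA; rewrite ge_min lexx orbT andbT lt_min e0 andbT.
  by move: e''0; rewrite /= in_itv/= andbT.
by apply: le_packing_content; rewrite ge_min lexx.
Qed.

Lemma packing_measureE s A : packing_measure s A =
  cover_content (packing_premeasure s) (fun=> True) A.
Proof.
rewrite /packing_measure /cover_content; congr (ereal_inf (_ @` _)).
by apply/seteqP; split => [U AU//|U []].
Qed.

Lemma sub_packing_eq0 s A B :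
  A `<=` B -> packing_measure s B = 0 -> packing_measure s A = 0.
Proof.
rewrite !packing_measureE => AB B0; apply/eqP.
rewrite eq_le cover_content_ge0 ?andbT//; last exact: packing_premeasure_ge0.
by rewrite -B0 le_cover_content.
Qed.

Lemma bigcup_packing_eq0 s (F : nat -> set X) :
  (forall k, packing_measure s (F k) = 0) ->
  packing_measure s (\bigcup_k F k) = 0.
Proof.
move=> F0; rewrite packing_measureE cover_content_bigcup//.
  exact: packing_premeasure_ge0.
by move=> k; rewrite -packing_measureE.
Qed.

Lemma packing_eq0_le s t A : (0 <= s <= t)%R ->
  packing_measure s A = 0 -> packing_measure t A = 0.
Proof.
move=> /andP[s0 st]; rewrite !packing_measureE.
apply: (@cover_content_transfer _ _ _ _ _ _ _ id 1%R) => //.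
- exact: packing_premeasure_ge0.
- exact: packing_premeasure_ge0.
move=> U _; split=> //; rewrite mul1e.
apply: (@le_packing_premeasure _ _ _ 1%R) => // e /andP[e0 e1].
apply: (le_trans (packing_premeasure_le _ _ e0)).
apply: ge_ereal_sup => _ [F FU <-]; apply: le_ereal_sup_tmp.
exists (\esum_(p in F) (p.2 `^ s)%:E); first by exists F.
apply: le_esum => p /FU.1[_ /andP[p0 pe]].
by rewrite lee_fin; apply: ger_powR; rewrite // p0 (le_trans pe).
Qed.

End packing.

Lemma esumZl_le (R : realType) (I : choiceType) (D : set I)
    (a : I -> \bar R) (c : R) : 0 <= c -> (forall i, 0 <= a i)%E ->
  (\esum_(i in D) (c%:E * a i) <= c%:E * \esum_(i in D) a i)%E.
Proof.
move=> c0 a0; apply: ge_ereal_sup => _ [F [finF FD] <-].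
rewrite -ge0_mule_fsumr// lee_wpmul2l//.
by apply: esum_ge; exists F.
Qed.

Section packing_image.
Context {R : realType} {T : Type} {X Y : metricType R}.
Variables (phi : T -> X) (psi : T -> Y) (A : set T) (C kappa delta : R).
Hypotheses (C0 : 0 < C) (kappa0 : 0 < kappa) (delta0 : 0 < delta).
Hypothesis meet_balls : forall x z r r', A x -> A z ->
  0 < r <= delta -> 0 < r' <= delta ->
  ball (phi x) r `&` ball (phi z) r' !=set0 ->
  ball (psi x) (C * r `^ kappa) `&` ball (psi z) (C * r' `^ kappa) !=set0.

(** A packing on the side of [psi] is pulled back to the side of [phi], a ball of radius r becoming
    one of radius (r / C)^(1/kappa). By [meet_balls], if two of the new balls met, so would the old
    ones; hence the new family is again a packing. *)
Lemma packing_premeasure_image s B : 0 < s -> B `<=` A ->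
  (packing_premeasure s (psi @` B) <=
   (C `^ s)%:E * packing_premeasure (kappa * s) (phi @` B))%E.
Proof.
move=> s0 BA; have Cs0 : 0 < C `^ s by rewrite powR_gt0.
rewrite muleC -lee_pdivrMr//.
apply: (@le_packing_premeasure _ _ _ _ _ delta) => // e /andP[e0 ed].
rewrite lee_pdivrMr// muleC.
have e'0 : 0 < C * e `^ kappa by rewrite mulr_gt0// powR_gt0.
apply: (le_trans (packing_premeasure_le _ _ e'0)).
apply: ge_ereal_sup => _ [F [FB tF] <-].
have [F0|/set0P[q0 Fq0]] := eqVneq F set0.
  by rewrite F0 esum_set0 mule_ge0 ?lee_fin ?powR_ge0 ?packing_content_ge0.
have [x0 _ _] := (FB _ Fq0).1.
(* [psi] need not be injective: a preimage in [B] is chosen for each centre, with [x0] as a dummy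
   elsewhere. *)
have [g gB] : {g : Y -> T & forall y, (psi @` B) y -> B (g y) /\ psi (g y) = y}.
  apply: (@choice _ _ (fun y x => (psi @` B) y -> B x /\ psi x = y)) => y.
  by have [[x Bx xy]|nB] := pselect ((psi @` B) y); [exists x|exists x0].
have [m [m1 m2]] : exists m : Y * R -> X * R,
    (forall p, (m p).1 = phi (g p.1)) /\
    (forall p, (m p).2 = (p.2 / C) `^ kappa^-1).
  by exists (fun p => (phi (g p.1), (p.2 / C) `^ kappa^-1)).
have m20 p : F p -> 0 < (m p).2 <= delta /\ (m p).2 <= e.
  move=> /FB[_ /andP[p0 pe]]; have pC : 0 < p.2 / C by rewrite divr_gt0.
  have me : (m p).2 <= e.
    rewrite m2; have -> : e = (e `^ kappa) `^ kappa^-1.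
      by rewrite -powRrM mulfV ?gt_eqF// powRr1// ltW.
    apply: ge0_ler_powR; rewrite ?nnegrE ?powR_ge0 ?invr_ge0//; try exact: ltW.
    by rewrite ler_pdivrMr// mulrC.
  by split=> //; rewrite (le_trans me ed) andbT m2 powR_gt0.
have m2K p : F p -> C * (m p).2 `^ kappa = p.2.
  move=> /FB[_ /andP[p0 pe]]; rewrite m2 -powRrM mulVf ?gt_eqF//.
  by rewrite powRr1 ?divr_ge0 ?ltW// mulrC divfK ?gt_eqF.
have meet p q : F p -> F q ->
    ball (m p).1 (m p).2 `&` ball (m q).1 (m q).2 !=set0 -> p = q.
  move=> Fp Fq; rewrite !m1 => pq; apply: tF => //.
  have [[Bp gp] [Bq gq]] := (gB _ (FB _ Fp).1, gB _ (FB _ Fq).1).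
  have := meet_balls (BA _ Bp) (BA _ Bq) (m20 _ Fp).1 (m20 _ Fq).1 pq.
  by rewrite (m2K _ Fp) (m2K _ Fq) gp gq.
(* Two balls with the same pull-back would meet, so no term of the sum is lost when it is
   reindexed. *)
have mbij : set_bij F (m @` F) m.
  split; [by move=> p Fp; exists p| |by move=> _ [p Fp <-]; exists p].
  move=> p q /set_mem Fp /set_mem Fq pq.
  apply: meet => //; rewrite pq setIid; exists (m q).1.
  by rewrite ballEmdist/= mdistxx; case/andP: (m20 _ Fq).1.
apply: (@le_trans _ _ (\esum_(p in F) ((C `^ s)%:E *
    ((m p).2 `^ (kappa * s))%:E))%E).
  apply: le_esum => p Fp; rewrite -EFinM lee_fin powRrM -powRM ?powR_ge0//.
    by rewrite m2K.
  exact: ltW.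
apply: (le_trans (@esumZl_le _ _ _ (fun p => ((m p).2 `^ (kappa * s))%:E)
    _ (powR_ge0 _ _) _)).
  by move=> p; rewrite lee_fin powR_ge0.
rewrite lee_wpmul2l ?lee_fin ?powR_ge0//; apply: ereal_sup_ubound.
exists (m @` F); last exact: reindex_esum.
split=> [_ [p Fp <-]|].
  split; first by exists (g p.1); rewrite ?m1//; have [] := gB _ (FB _ Fp).1.
  by have [/andP[-> _] ->] := m20 _ Fp.
by move=> _ _ [p Fp <-] [q Fq <-] /(meet _ _ Fp Fq) ->.
Qed.

Lemma packing_eq0_image s : 0 < s ->
  packing_measure (kappa * s) (phi @` A) = 0%E ->
  packing_measure s (psi @` A) = 0%E.
Proof.
move=> s0; rewrite !packing_measureE.
apply: (@cover_content_transfer _ _ _ _ _ _ _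
  (fun U => psi @` (A `&` phi @^-1` U)) (C `^ s)) => //.
- exact: powR_ge0.
- exact: packing_premeasure_ge0.
- exact: packing_premeasure_ge0.
- move=> U _; split=> //.
  apply: (le_trans (packing_premeasure_image s0 (@subIsetl _ _ _))).
  rewrite lee_wpmul2l ?lee_fin ?powR_ge0//.
  apply: (@le_packing_premeasure _ _ _ _ _ 1) => // e /andP[e0 _].
  apply: (le_trans (packing_premeasure_le _ _ e0)).
  apply: ereal_sup_le => _ [F [FA tF] <-]; exists F => //; split=> // p /FA.
  by move=> [[x [_ Ux] <-]].
- move=> U AU _ [x Ax <-].
  by have [k _ Ux] := AU _ (imageP _ Ax); exists k => //; exists x.
Qed.

End packing_image.

(** * The dimension formula for abstract families of null sets *)

Section dimension_formula.
Context {R : realType} {TX TY : Type}.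
Variables (nullX : R -> set TX -> Prop) (nullY : R -> set TY -> Prop).
Variables (B : set TX) (h : TX -> TY) (i : TX -> R) (U L : R -> nat -> set TX).

(** [hausdorff_dim] and [packing_dim] both unfold to this. *)
Definition null_dim (T : Type) (null : R -> set T -> Prop) (A : set T) :
    \bar R :=
  ereal_inf [set s%:E | s in [set s | 0 <= s /\ null s A]].

Hypothesis nullX_le : forall (s t : R) A, 0 <= s <= t -> nullX s A -> nullX t A.
Hypothesis nullY_le : forall (s t : R) A, 0 <= s <= t -> nullY s A -> nullY t A.
Hypothesis sub_nullX : forall s A A', A `<=` A' -> nullX s A' -> nullX s A.
Hypothesis sub_nullY : forall s A A', A `<=` A' -> nullY s A' -> nullY s A.
Hypothesis bigcup_nullX : forall s (F : nat -> set TX),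
  (forall k, nullX s (F k)) -> nullX s (\bigcup_k F k).
Hypothesis bigcup_nullY : forall s (F : nat -> set TY),
  (forall k, nullY s (F k)) -> nullY s (\bigcup_k F k).
Hypothesis nullY_image : forall (q : R) k (s : R) A, 0 < q -> 0 < s ->
  A `<=` U q k -> nullX (q * s) A -> nullY s (h @` A).
Hypothesis nullX_image : forall (q : R) k (s : R) A, 0 < q -> 0 < s ->
  A `<=` L q k -> nullY s (h @` A) -> nullX (q * s) A.
Hypothesis bigcup_U : forall x (q : R), B x -> 0 < q < 1 + i x ->
  exists k, U q k x.
Hypothesis bigcup_L : forall x (q : R), B x -> 1 + i x < q -> exists k, L q k x.
Hypothesis i_gtN1 : forall x, B x -> -1 < i x.

Let sublevel beta := [set x | B x /\ i x <= beta].

Lemma null_dim_ge0 T (null : R -> set T -> Prop) (A : set T) :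
  (0 <= null_dim null A)%E.
Proof. by apply: le_ereal_inf_tmp => _ [s [s0 _] <-]. Qed.

Lemma bigcup_countType_nullY (I : countType) s (F : I -> set TY) (i0 : I) :
  (forall k, nullY s (F k)) -> nullY s (\bigcup_k F k).
Proof.
move=> F0.
apply: sub_nullY (bigcup_nullY (F := F \o odflt i0 \o unpickle) _).
  by move=> x [k _ Fx]; exists (pickle k) => //=; rewrite pickleK.
by move=> k; exact: F0.
Qed.

(** Let [s] exceed the supremum [S], and let [lam > 1] satisfy [S * lam < s]. The part of [U q k]
    where 1 + i <= lam * q lies in the sublevel of lam * q - 1, whose dimension is at most lam * q *
    S < q * s. It is null at [q * s], hence its image is null at [s]; rational [q] make these parts
    countable in number. *)
Lemma null_dim_image_le :
  (null_dim nullY (h @` B) <= ereal_sup [set (((1 + beta)^-1)%:E *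
    null_dim nullX (sublevel beta))%E |
    beta in [set beta : R | (-1 < beta)%R]])%E.
Proof.
set S := ereal_sup _.
have S0 : (0 <= S)%E.
  apply: le_ereal_sup_tmp; exists (((1 + 0)^-1)%:E *
    null_dim nullX (sublevel 0%R))%E.
    by exists 0 => //=; rewrite ltrN10.
  by rewrite mule_ge0 ?null_dim_ge0// lee_fin addr0 invr1.
have : forall beta, -1 < beta ->
    (((1 + beta)^-1)%:E * null_dim nullX (sublevel beta) <= S)%E.
  by move=> b b1; apply: ereal_sup_ubound; exists b.
move: S S0 => [S||]//; last by move=> _ _; rewrite leey.
rewrite lee_fin => S0 dimS.
apply/lee_addgt0Pr => e e0; pose s := S + e.
have s0 : 0 < s by rewrite ltr_wpDl.
apply: ereal_inf_lbound; exists s => //; split; first exact: ltW.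
pose lam := 1 + e / (2 * (S + 1)).
have S1 : 0 < S + 1 by rewrite ltr_wpDl.
have lam1 : 1 < lam by rewrite ltrDl divr_gt0// mulr_gt0.
have lam0 : 0 < lam by exact: lt_trans lam1.
have Slam : S * lam < s.
  rewrite /lam mulrDr mulr1 ltrD2l mulrA ltr_pdivrMr ?mulr_gt0//.
  nra.
(* [lam] is so close to 1 that the points with 1 + i between q and lam * q
   can be treated as if i were constant. *)
pose val (q : rat) : R := if 0 < ratr q :> R then ratr q else 1.
(* The dummy value 1 at nonpositive rationals gives every index of [E] a positive exponent. *)
have val0 q : 0 < val q by rewrite /val; case: ifP.
pose E (p : rat * nat) := [set x | B x /\
  (i x <= lam * val p.1 - 1 /\ U (val p.1) p.2 x)].
apply: (@sub_nullY _ _ (\bigcup_p (h @` E p))).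
  move=> _ [x Bx <-]; have ix := i_gtN1 Bx.
  have ix0 : 0 < 1 + i x by rewrite addrC -ltrBlDr sub0r.
  have : (1 + i x) / lam < 1 + i x by rewrite ltr_pdivrMr// ltr_pMr.
  move=> /rat_in_itvoo[q]; rewrite in_itv/= => /andP[iq qi].
  have q0 : 0 < ratr q :> R by rewrite (lt_trans _ iq)// divr_gt0.
  have vq : val q = ratr q by rewrite /val q0.
  have [|k Uk] := @bigcup_U x (val q) Bx; first by rewrite val0 vq.
  exists (q, k) => //; exists x => //; split=> //; split=> //=.
  by move: iq; rewrite vq ltr_pdivrMr// mulrC => /ltW; rewrite lerBrDl.
apply: (bigcup_countType_nullY (0, 0%N)) => -[q k].
have q0 := val0 q; apply: (@nullY_image (val q) k) => //.
  by move=> x [_ []].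
have lq0 : 0 < lam * val q by rewrite mulr_gt0.
have b1 : -1 < lam * val q - 1 by rewrite ltrBrDl subrr.
have := dimS _ b1; rewrite addrC subrK lee_pdivrMl// => dimb.
have : (null_dim nullX (sublevel (lam * val q - 1)%R) < (val q * s)%:E)%E.
  apply: (le_lt_trans dimb); rewrite -EFinM lte_fin mulrAC mulrC ltr_pM2l//.
  by rewrite mulrC.
move=> /ereal_inf_lt[_ [t [t0 nt] <-]]; rewrite lte_fin => /ltW tq.
apply: sub_nullX (nullX_le _ nt); last by rewrite t0.
by move=> x [Bx [ix _]].
Qed.

(** One exponent slightly above 1 + beta serves all points of the sublevel, which is then split by
    [k] only. *)
Lemma null_dim_image_ge :
  (ereal_sup [set (((1 + beta)^-1)%:E * null_dim nullX (sublevel beta))%E |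
    beta in [set beta : R | (-1 < beta)%R]] <= null_dim nullY (h @` B))%E.
Proof.
apply: ge_ereal_sup => _ [b b1 <-].
have b0 : 0 < 1 + b by rewrite addrC -ltrBlDr sub0r.
rewrite lee_pdivrMl//.
suff le_dim t : 0 <= t -> nullY t (h @` B) ->
    (null_dim nullX (sublevel b) <= ((1 + b) * t)%:E)%E.
  rewrite -lee_pdivrMl//; apply: le_ereal_inf_tmp => _ [t [t0 nt] <-].
  by rewrite lee_pdivrMl// -EFinM; exact: le_dim.
move=> t0 nt; apply/lee_addgt0Pr => e e0.
(* (1 + b + d) * (t + d) exceeds (1 + b) * t by d * (1 + b + t + d), at most d * (2 + b + t) since d
   <= 1. Adding [d] to [t] also makes the exponent positive when [t = 0]. *)
pose d := Num.min 1 (e / (2 + b + t)).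
have bt0 : 0 < 2 + b + t by lra.
have d0 : 0 < d by rewrite lt_min ltr01 divr_gt0.
have d1 : d <= 1 by rewrite ge_min lexx.
have de : d * (2 + b + t) <= e.
  by rewrite -ler_pdivlMr// ge_min lexx orbT.
apply: (@le_trans _ _ ((1 + b + d) * (t + d))%:E); last first.
  rewrite -EFinD lee_fin; nra.
apply: ereal_inf_lbound; exists ((1 + b + d) * (t + d)) => //.
have q0 : 0 < 1 + b + d by rewrite addr_gt0.
have td0 : 0 < t + d by rewrite ltr_wpDl.
split; first by rewrite mulr_ge0// ltW.
apply: (@sub_nullX _ _ (\bigcup_k (sublevel b `&` L (1 + b + d) k))).
  move=> x [Bx ib]; have [|k Lk] := @bigcup_L x (1 + b + d) Bx; first by lra.
  by exists k.
apply: bigcup_nullX => k; apply: (@nullX_image _ k) => //.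
apply: sub_nullY (nullY_le _ nt); last by rewrite t0 lerDl ltW.
by move=> _ [x [[Bx _] _] <-]; exists x.
Qed.

Lemma null_dim_image :
  null_dim nullY (h @` B) = ereal_sup [set (((1 + beta)^-1)%:E *
    null_dim nullX (sublevel beta))%E | beta in [set beta : R | (-1 < beta)%R]].
Proof.
by apply/eqP; rewrite eq_le null_dim_image_le null_dim_image_ge.
Qed.

End dimension_formula.

(** * Curves and their lengths *)

Section euclid_norm.
Context {R : realType} {n : nat}.
Implicit Types v w : 'rV[R]_n.

Lemma euclid_norm_ge0 v : 0 <= euclid_norm v.
Proof. exact: sqrtr_ge0. Qed.

Lemma euclid_normZ c v : euclid_norm (c *: v) = `|c| * euclid_norm v.
Proof.
rewrite /euclid_norm -sqrtr_sqr -sqrtrM ?sqr_ge0// mulr_sumr.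
by congr Num.sqrt; apply: eq_bigr => j _; rewrite mxE exprMn.
Qed.

Lemma euclid_normN v : euclid_norm (- v) = euclid_norm v.
Proof. by rewrite -scaleN1r euclid_normZ normrN1 mul1r. Qed.

Lemma coord_le_euclid_norm v j : `|v ord0 j| <= euclid_norm v.
Proof.
rewrite -sqrtr_sqr ler_sqrt ?sumr_ge0// => [|k _]; last exact: sqr_ge0.
by rewrite (bigD1 j)//= lerDl sumr_ge0// => k _; exact: sqr_ge0.
Qed.

Lemma norm_le_euclid_norm v : `|v| <= euclid_norm v.
Proof.
rewrite [leLHS]mx_normrE; apply/bigmax_leP; split=> [|[k j] _ /=].
  exact: euclid_norm_ge0.
by rewrite ord1 coord_le_euclid_norm.
Qed.

Lemma ler_euclid_norm v c : 0 <= c -> (forall j, `|v ord0 j| <= c) ->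
  euclid_norm v <= n%:R * c.
Proof.
move=> c0 vc; have nc0 : 0 <= n%:R * c by rewrite mulr_ge0.
rewrite -(ger0_norm nc0) -sqrtr_sqr ler_sqrt ?sqr_ge0// exprMn.
apply: (@le_trans _ _ (\sum_(j < n) c ^+ 2)).
  apply: ler_sum => j _; rewrite -(real_normK (num_real (v ord0 j))).
  by rewrite ler_pXn2r// nnegrE.
rewrite sumr_const card_ord -[leLHS]mulr_natl ler_wpM2r ?sqr_ge0//.
by rewrite -natrX ler_nat -mulnn; case: (n) => // k; rewrite leq_pmulr.
Qed.

Lemma euclid_norm0_eq v : euclid_norm v = 0 -> v = 0.
Proof.
move=> v0; apply/rowP => j; rewrite mxE; apply/eqP.
by rewrite -normr_le0 -v0 coord_le_euclid_norm.
Qed.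

End euclid_norm.

Section curves.
Context {R : realType} {n : nat}.
Implicit Types (Omega : set 'rV[R]_n) (rho : 'rV[R]_n -> R).
Implicit Types (x y v w : 'rV[R]_n).
Implicit Types (g : R -> 'rV[R]_n) (s t L : R).

Lemma curve_lengthss s g : curve_length s s g = 0%E.
Proof.
rewrite /curve_length (_ : [set _ | _ in _] = [set 0%E]) ?ereal_sup1//.
apply/seteqP; split => [_ [[|a u] [pu /eqP lu] <-]|_ ->].
- by rewrite /polygon_length big_geq.
- have : last a u \in a :: u by rewrite mem_last.
  move: pu => /= /andP[sa pu]; move: lu => /= ->.
  have : all (<%O s) (a :: u).
    by apply: order_path_min; [exact: lt_trans|rewrite /= sa].
  by move=> /allP /[apply]; rewrite ltxx.
- by exists [::]; [split => //=|rewrite /polygon_length big_geq].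
Qed.

Lemma polygon_length_affine s t x w u : euclid_norm w = 1 ->
  itv_partition s t u ->
  polygon_length s t (fun r => x + r *: w) u = t - s.
Proof.
move=> w1 [pu /eqP lu]; rewrite /polygon_length /=.
rewrite (eq_big_nat _ _
  (F2 := fun k => nth t (s :: u) k.+1 - nth t (s :: u) k)).
  rewrite telescope_sumr//=; congr (_ - _).
  by rewrite -[RHS]lu (last_nth t).
move=> k /andP[_ ku]; rewrite opprD addrACA subrr add0r -scalerBl.
rewrite euclid_normZ w1 mulr1 ger0_norm// subr_ge0 ltW//.
by move/(pathP t) : pu; apply.
Qed.

Lemma curve_length_affine s t x w : euclid_norm w = 1 -> s <= t ->
  curve_length s t (fun r => x + r *: w) = (t - s)%:E.
Proof.
move=> w1; rewrite le_eqVlt => /predU1P[->|st].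
  by rewrite curve_lengthss subrr.
rewrite /curve_length (_ : [set _ | _ in _] = [set (t - s)%:E]) ?ereal_sup1//.
apply/seteqP; split => [_ [u su <-]|_ ->].
  by rewrite /= polygon_length_affine.
have tp : itv_partition s t [:: t] by split => //=; rewrite st.
by exists [:: t] => //; rewrite polygon_length_affine.
Qed.

Lemma is_curve_segment Omega x v :
  (forall t, 0 <= t <= 1 -> Omega (x + t *: v)) ->
  is_curve Omega x (x + v) (euclid_norm v)
    (fun t => x + t *: ((euclid_norm v)^-1 *: v)).
Proof.
move=> Ov; have [/[dup] v0 /euclid_norm0_eq ->|v0] := eqVneq (euclid_norm v) 0.
  split; rewrite ?scaler0 ?addr0 ?euclid_norm_ge0//.
    move=> t _; rewrite !scaler0 addr0.
    by have := Ov 0; rewrite scale0r addr0 lexx ler01; apply.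
  have -> : euclid_norm (0 : 'rV[R]_n) = 0.
    by rewrite -(scale0r (0 : 'rV[R]_n)) euclid_normZ normr0 mul0r.
  move=> s t s0 st t0.
  have -> : s = t by apply/eqP; rewrite eq_le st (le_trans t0).
  by rewrite curve_lengthss subrr.
have vp : 0 < euclid_norm v by rewrite lt_neqAle eq_sym v0 euclid_norm_ge0.
split=> [|||t|s t _ st _].
- exact: ltW.
- by rewrite scale0r addr0.
- by rewrite scalerA divff// scale1r.
- move=> /andP[t0 tv]; rewrite scalerA; apply: Ov.
  by rewrite ler_pdivrMr// mul1r tv divr_ge0// ltW.
- rewrite curve_length_affine// euclid_normZ ger0_norm ?mulVf//.
  by rewrite invr_ge0 ltW.
Qed.

Lemma is_curve_sub Omega x y L g t : is_curve Omega x y L g ->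
  0 <= t <= L -> is_curve Omega x (g t) t g.
Proof.
move=> [L0 g0 gL Og lg] /andP[t0 tL]; split=> // [s /andP[s0 st]|s u s0 su ut].
  by apply: Og; rewrite s0 (le_trans st).
by apply: lg => //; exact: le_trans tL.
Qed.

Lemma is_curve_lip Omega x y L g s t : is_curve Omega x y L g ->
  0 <= s -> s <= t -> t <= L -> euclid_norm (g t - g s) <= t - s.
Proof.
move=> [L0 g0 gL Og lg] s0 st tL; rewrite -lee_fin -(lg _ _ s0 st tL).
move: st; rewrite le_eqVlt => /predU1P[->|st].
  by rewrite curve_lengthss subrr -(scale0r 0) euclid_normZ normr0 mul0r.
apply: ereal_sup_ubound; exists [:: t]; first by split => //=; rewrite st.
by rewrite /polygon_length /= big_nat1.
Qed.

Lemma inner_dist_le Omega x y L g :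
  is_curve Omega x y L g -> (inner_dist Omega x y <= L%:E)%E.
Proof. by move=> c; apply: ereal_inf_lbound; exists L, g. Qed.

Lemma rho_dist_le Omega rho x y L g : is_curve Omega x y L g ->
  (rho_dist Omega rho x y <= rho_length rho L g)%E.
Proof. by move=> c; apply: ereal_inf_lbound; exists L, g. Qed.

End curves.

Section clamp.
Context {R : realType}.
Implicit Types L s t : R.

(* [g \o clamp L] extends a curve [g] on [0, L] continuously to the line. *)
Definition clamp L t : R := Num.max 0 (Num.min L t).

Lemma clamp_id L t : 0 <= t <= L -> clamp L t = t.
Proof. by move=> /andP[t0 tL]; rewrite /clamp min_r// max_r. Qed.

Lemma clamp_itv L t : 0 <= L -> 0 <= clamp L t <= L.
Proof. by move=> L0; rewrite le_max lexx/= ge_max L0/= ge_min lexx. Qed.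

Lemma le_clamp L s t : s <= t -> clamp L s <= clamp L t.
Proof. by move=> st; apply: le_max2; rewrite // le_min2. Qed.

Lemma clamp_lip L s t : s <= t -> clamp L t - clamp L s <= t - s.
Proof.
rewrite /clamp /Order.max /Order.min => st.
repeat match goal with |- context [if ?a < ?b then _ else _] =>
  case: (ltP a b) end; by move=> *; lra.
Qed.

End clamp.

(** * Integrals along curves *)

Lemma integral_cst_segment (R : realType) (m L : R) : 0 <= L ->
  (\int[lebesgue_measure]_(t in `[0%R, L]) (cst m%:E) t = (m * L)%:E)%E.
Proof.
move=> L0; rewrite integral_cst//= lebesgue_measure_itv/= lte_fin.
case: ltP => [_|L0']; first by rewrite -EFinD -EFinM subr0.
by rewrite mule0 (_ : L = 0) ?mulr0//; apply/eqP; rewrite eq_le L0'.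
Qed.

(** The shift avoids the singularity at 0, and the bound stays finite as [tau] tends to 0: the
    primitive (t + tau)^(1 + a) / (1 + a) has a positive exponent. Its value at 0 is dropped. *)
Lemma integral_powR_shift (R : realType) (a tau L : R) :
  -1 < a -> 0 < tau -> 0 <= L ->
  (\int[lebesgue_measure]_(t in `[0%R, L]) ((t + tau) `^ a)%:E <=
   ((1 + a)^-1 * (L + tau) `^ (1 + a))%:E)%E.
Proof.
move=> a1 tau0; rewrite le_eqVlt => /predU1P[<-|L0].
  rewrite set_itv1 integral_set1 lee_fin mulr_ge0 ?powR_ge0// invr_ge0.
  by lra.
have a10 : 0 < 1 + a by lra.
have dG (b t : R) : 0 <= t ->
    is_derive t 1 ((fun u : R => u `^ b) \o (fun u => u + tau))
      (b * (t + tau) `^ (b - 1) * 1).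
  move=> t0; have tt : 0 < t + tau by rewrite ltr_wpDl.
  have dt : is_derive t 1 (fun t : R => t + tau) 1.
    by rewrite -[X in is_derive _ _ _ X]addr0; apply: is_deriveD.
  exact: (@is_derive1_comp _ (fun u : R => u `^ b) (fun u => u + tau)
    t _ _ (is_derive1_powR b tt) dt).
pose F := (1 + a)^-1 \*: ((fun u : R => u `^ (1 + a)) \o (fun u => u + tau)).
have dF (t : R) : 0 <= t -> is_derive t 1 F ((t + tau) `^ a).
  move=> t0; have dZ := is_deriveZ (1 + a)^-1 (dG (1 + a) _ t0).
  apply: is_derive_eq.
  by rewrite mulr1 scalerA mulVf ?gt_eqF// scale1r addrAC subrr add0r.
have cF (t : R) : 0 <= t -> {for t, continuous F}.
  by move=> /dF[+ _] => /derivable1_diffP/differentiable_continuous.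
rewrite (@continuous_FTC2 _ _ F)//.
- by rewrite -EFinB lee_fin lerBlDr lerDl mulr_ge0 ?powR_ge0// invr_ge0 ltW.
- apply: continuous_in_subspaceT => t; rewrite inE/= in_itv/= => /andP[t0 _].
  have [d _] := dG a t t0.
  by move: d => /derivable1_diffP/differentiable_continuous.
- split.
  + by move=> t; rewrite in_itv/= => /andP[/ltW/dF[]].
  + by apply: cvg_at_right_filter; exact: cF.
  + by apply: cvg_at_left_filter; apply: cF; exact: ltW.
- move=> t; rewrite in_itv/= => /andP[/ltW/dF t0 _].
  by rewrite derive1E derive_val.
Qed.

Section rho_length.
Context {R : realType} {n : nat}.
Variables (Omega : set 'rV[R]_n) (rho : 'rV[R]_n -> R).
Hypothesis open_Omega : open Omega.
Hypothesis continuous_rho : {within Omega, continuous rho}.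
Hypothesis rho_gt0 : forall x, Omega x -> 0 < rho x.
Implicit Types (x y : 'rV[R]_n) (g : R -> 'rV[R]_n) (L : R).

Lemma curve_clamp_lip x y L g s t : is_curve Omega x y L g ->
  euclid_norm (g (clamp L t) - g (clamp L s)) <= `|t - s|.
Proof.
move=> c; have [L0 _ _ _ _] := c; wlog st : s t / s <= t => [wl|].
  have [/wl //|/ltW/wl] := leP s t.
  by rewrite (distrC t) -opprB euclid_normN.
have /andP[s0 _] := clamp_itv s L0; have /andP[_ tL] := clamp_itv t L0.
apply: le_trans (is_curve_lip c s0 (le_clamp _ st) tL) _.
by apply: le_trans (clamp_lip _ st) _; rewrite ler_norm.
Qed.

Lemma continuous_curve_clamp x y L g : is_curve Omega x y L g ->
  continuous (g \o clamp L).
Proof.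
move=> c t; apply/cvgrPdist_lt => e e0; exists e => //= s ts.
apply: le_lt_trans ts; apply: le_trans (norm_le_euclid_norm _) _.
exact: curve_clamp_lip c.
Qed.

Lemma continuous_rho_curve x y L g : is_curve Omega x y L g ->
  continuous (rho \o g \o clamp L).
Proof.
move=> c t; have [L0 _ _ Og _] := c.
apply: (@continuous_comp _ _ _ (g \o clamp L) rho).
  exact: continuous_curve_clamp c t.
move: continuous_rho; rewrite continuous_open_subspace//; apply.
by rewrite inE; apply: Og; exact: clamp_itv.
Qed.

Lemma measurable_rho_curve x y L g : is_curve Omega x y L g ->
  measurable_fun `[0, L] (rho \o g).
Proof.
move=> c; apply: (@eq_measurable_fun _ _ _ _ _ (rho \o g \o clamp L)).
  by move=> t; rewrite inE/= in_itv/= => tL; rewrite clamp_id.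
apply: (@measurable_funS _ _ _ _ setT) => //.
apply: continuous_measurable_fun; exact: (continuous_rho_curve c).
Qed.

Lemma rho_length_le x y L g M : is_curve Omega x y L g ->
  (forall t, 0 <= t <= L -> rho (g t) <= M) ->
  (rho_length rho L g <= (M * L)%:E)%E.
Proof.
move=> c gM; have [L0 _ _ Og _] := c.
apply: (@le_trans _ _ (\int[lebesgue_measure]_(t in `[0%R, L]) (cst M%:E) t)%E).
  apply: ge0_le_integral => //= [t|].
  - by rewrite in_itv/= => /Og/rho_gt0/ltW; rewrite lee_fin.
  - apply/measurable_EFinP; exact: measurable_rho_curve c.
by rewrite integral_cst_segment.
Qed.

Lemma rho_length_ge x y L g m r : is_curve Omega x y L g -> 0 <= m ->
  0 <= r <= L -> (forall t, 0 <= t <= r -> m <= rho (g t)) ->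
  ((m * r)%:E <= rho_length rho L g)%E.
Proof.
move=> c m0 /andP[r0 rL] gm; have [L0 _ _ Og _] := c.
apply: (@le_trans _ _ (\int[lebesgue_measure]_(t in `[0%R, r])
    (rho (g t))%:E)%E); last first.
  apply: ge0_subset_integral => //=.
  - apply/measurable_EFinP; exact: measurable_rho_curve c.
  - by move=> t; rewrite in_itv/= => /Og/rho_gt0/ltW; rewrite lee_fin.
  - by apply: subset_itvl; rewrite bnd_simp.
have cr := is_curve_sub c; have := cr r; rewrite r0 rL => /(_ isT){}cr.
apply: (@le_trans _ _ (\int[lebesgue_measure]_(t in `[0%R, r]) (cst m%:E) t)%E).
  by rewrite integral_cst_segment.
apply: ge0_le_integral => //=.
by apply/measurable_EFinP; exact: measurable_rho_curve cr.
Qed.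

Lemma rho_length_powR x y L g a tau K : is_curve Omega x y L g ->
  -1 < a -> 0 < tau -> 0 <= K ->
  (forall t, 0 <= t <= L -> rho (g t) <= K * (t + tau) `^ a) ->
  (rho_length rho L g <= (K * ((1 + a)^-1 * (L + tau) `^ (1 + a)))%:E)%E.
Proof.
move=> c a1 tau0 K0 gK; have [L0 _ _ Og _] := c.
have mp : measurable_fun `[0, L] (fun t : R => (t + tau) `^ a).
  apply: (@measurable_funS _ _ _ _ setT) => //.
  apply: (@measurableT_comp _ _ _ _ _ _ (@powR R ^~ a)) => //.
  exact: measurable_funD.
apply: (@le_trans _ _ (\int[lebesgue_measure]_(t in `[0%R, L])
    (K%:E * ((t + tau) `^ a)%:E))%E).
  apply: ge0_le_integral => //= [t||].
  - by rewrite in_itv/= => /Og/rho_gt0/ltW; rewrite lee_fin.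
  - by apply/measurable_EFinP; exact: measurable_rho_curve c.
  - by apply/measurable_EFinP; exact: measurable_funM.
rewrite ge0_integralZl_EFin//=.
- by rewrite EFinM lee_wpmul2l// integral_powR_shift.
- by move=> t _; rewrite lee_fin powR_ge0.
- exact/measurable_EFinP.
Qed.

End rho_length.

Lemma coord_le_norm (R : realType) n (v : 'rV[R]_n) j : `|v ord0 j| <= `|v|.
Proof.
by rewrite [leRHS]mx_normrE; apply/bigmax_geP; right => /=; exists (ord0, j).
Qed.

(** * The internal metric and the distance to the boundary *)

Section completion_lemmas.
Context {R : realType} {T : Type}.
Variables (D : set T) (d : T -> T -> \bar R) (X : completion D d).

Lemma embed_near (p : X) e : 0 < e -> exists2 u, D u & mdist p (embed X u) < e.
Proof.
move=> e0; have pe : (ball p e)° p by exact: nbhsx_ballx.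
have [q [/interior_subset pq [u Du uq]]] :=
  @embed_dense _ _ _ _ X _ (ex_intro _ p pe) (@open_interior _ _).
by exists u => //; move: pq; rewrite ballEmdist -uq.
Qed.

Lemma completion_cauchy_seq (u : nat -> X) :
  (forall e, 0 < e -> exists N, forall m k, (N <= m)%N -> (N <= k)%N ->
    mdist (u m) (u k) < e) ->
  exists p : X, forall e, 0 < e -> exists N, forall k, (N <= k)%N ->
    mdist p (u k) < e.
Proof.
move=> uC; have [|p up] := @carrier_complete _ _ _ _ X (u @ \oo) _.
  apply: cauchy_exP => e e0; have [N uN] := uC e e0.
  by exists (u N); exists N => // k /= Nk; rewrite ballEmdist/=; exact: uN.
exists p => e e0; have /up[N _ uN] : nbhs p (ball p e) by exact: nbhsx_ballx.
by exists N => k /uN/=; rewrite ballEmdist.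
Qed.

End completion_lemmas.

Lemma invS_lt (R : realType) (e : R) : 0 < e ->
  exists N : nat, forall k, (N <= k)%N -> k.+1%:R^-1 < e.
Proof.
move=> e0; exists (Num.truncn e^-1) => k Nk.
rewrite invf_plt ?posrE ?ltr0n//.
apply: (lt_le_trans (truncnS_gt _)).
by rewrite ler_nat ltnS.
Qed.

Lemma row_cauchy_seq (R : realType) n (u : nat -> 'rV[R]_n) :
  (forall e, 0 < e -> exists N, forall m k, (N <= m)%N -> (N <= k)%N ->
    `|u m - u k| < e) ->
  exists y, forall e, 0 < e -> exists N, forall k, (N <= k)%N ->
    `|y - u k| < e.
Proof.
move=> uC; have /cvg_ex[y uy] : cvg (u @ \oo).
  apply: cauchy_cvg; apply: cauchy_exP => e e0; have [N uN] := uC e e0.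
  by exists (u N); exists N => // k /= Nk; rewrite -ball_normE/=; exact: uN.
exists y => e e0; have /uy[N _ uN] : nbhs y (ball y e) by exact: nbhsx_ballx.
by exists N => k /uN/=; rewrite -ball_normE.
Qed.

Section domain_metrics.
Context {R : realType} {n : nat}.
Variables (Omega : set 'rV[R]_n) (rho : 'rV[R]_n -> R).
Variables (Xd : completion Omega (inner_dist Omega)).
Variables (Xr : completion Omega (rho_dist Omega rho)).
Hypothesis open_Omega : open Omega.
Hypothesis continuous_rho : {within Omega, continuous rho}.
Hypothesis rho_gt0 : forall x, Omega x -> 0 < rho x.
Implicit Types (x y v w : 'rV[R]_n) (g : R -> 'rV[R]_n) (L : R).

Local Notation dX x y := (mdist (embed Xd x) (embed Xd y)).
Local Notation dY x y := (mdist (embed Xr x) (embed Xr y)).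

Lemma dX_le_curve x y L g t : is_curve Omega x y L g -> 0 <= t <= L ->
  dX x (g t) <= t.
Proof.
move=> c tL; have [L0 g0 _ Og _] := c; rewrite -lee_fin embed_isometry.
- exact: inner_dist_le (is_curve_sub c tL).
- by rewrite -g0; apply: Og; rewrite lexx.
- exact: Og.
Qed.

Lemma euclid_norm_le_dX x y : Omega x -> Omega y ->
  euclid_norm (y - x) <= dX x y.
Proof.
move=> Ox Oy; rewrite -lee_fin embed_isometry//.
apply: le_ereal_inf_tmp => _ [L [g [c ->]]]; have [L0 g0 gL _ _] := c.
by rewrite lee_fin -[leRHS]subr0 -[in leLHS]gL -g0 (is_curve_lip c).
Qed.

Lemma dX_curve_lt x y e : Omega x -> Omega y -> dX x y < e ->
  exists L g, is_curve Omega x y L g /\ L < e.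
Proof.
move=> Ox Oy; rewrite -lte_fin embed_isometry// => /ereal_inf_lt.
by move=> [_ [L [g [c ->]]]]; rewrite lte_fin => Le; exists L, g.
Qed.

Lemma segment_point x v t : 0 <= t <= euclid_norm v ->
  exists2 s, 0 <= s <= 1 & x + t *: ((euclid_norm v)^-1 *: v) = x + s *: v.
Proof.
move=> /andP[t0 tv]; have [v0|v0] := eqVneq (euclid_norm v) 0.
  by exists 0; rewrite ?lexx ?ler01// (euclid_norm0_eq v0) !scaler0.
have vp : 0 < euclid_norm v by rewrite lt_neqAle eq_sym v0 euclid_norm_ge0.
exists (t / euclid_norm v); last by rewrite scalerA.
by rewrite ler_pdivrMr// mul1r tv divr_ge0// ltW.
Qed.

Lemma dX_segment x v : (forall t, 0 <= t <= 1 -> Omega (x + t *: v)) ->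
  dX x (x + v) <= euclid_norm v.
Proof.
move=> Ov; rewrite -lee_fin embed_isometry.
- exact/inner_dist_le/(is_curve_segment Ov).
- by have := Ov 0; rewrite scale0r addr0 lexx ler01; apply.
- by have := Ov 1; rewrite scale1r lexx ler01; apply.
Qed.

Lemma dY_segment x v M : (forall t, 0 <= t <= 1 -> Omega (x + t *: v)) ->
  (forall t, 0 <= t <= 1 -> rho (x + t *: v) <= M) ->
  dY x (x + v) <= M * euclid_norm v.
Proof.
move=> Ov Mv; rewrite -lee_fin embed_isometry.
- have c := is_curve_segment Ov; apply: le_trans (rho_dist_le _ c) _.
  apply: (rho_length_le open_Omega continuous_rho rho_gt0 c) => t tv.
  by have [s s01 ->] := segment_point x tv; exact: Mv.
- by have := Ov 0; rewrite scale0r addr0 lexx ler01; apply.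
- by have := Ov 1; rewrite scale1r lexx ler01; apply.
Qed.

Lemma rho_bounded_near x : Omega x -> exists2 tau, 0 < tau & exists2 M, 0 < M &
  forall y, `|y - x| < tau -> Omega y /\ rho y <= M.
Proof.
move=> Ox; have Ro := rho_gt0 Ox.
have cx : {for x, continuous rho}.
  move: continuous_rho; rewrite continuous_open_subspace//; apply.
  by rewrite inE.
have : \forall y \near x, Omega y /\ rho y <= rho x + 1.
  near=> y; split.
    by near: y; exact: open_nbhs_nbhs.
  have : `|rho x - rho y| < 1.
    by near: y; move/cvgrPdist_lt : cx; apply.
  by rewrite ltr_norml => /andP[+ _]; rewrite ltrBrDr addrC ltrBlDr => /ltW.
move=> /nbhs_ballP[tau /= tau0 xt]; exists tau => //; exists (rho x + 1).
  by rewrite addr_gt0.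
by move=> y yx; apply: xt; rewrite -ball_normE/= distrC.
Unshelve. all: by end_near. Qed.

(** Inside a ball where [rho] is bounded by [M], the straight segment is a competitor for both
    distances. Hence both embeddings are continuous on [Omega] for the Euclidean topology. *)
Lemma local_comparison x : Omega x -> exists2 tau, 0 < tau & exists2 M, 0 < M &
  forall y, euclid_norm (y - x) < tau ->
    [/\ Omega y, dX x y <= euclid_norm (y - x) &
        dY x y <= M * euclid_norm (y - x)].
Proof.
move=> Ox; have [tau t0 [M M0 xM]] := rho_bounded_near Ox.
exists tau => //; exists M => // y yx.
have seg t : 0 <= t <= 1 -> `|x + t *: (y - x) - x| < tau.
  move=> /andP[t0' t1]; rewrite addrC addKr.
  apply: le_lt_trans (norm_le_euclid_norm _) _; apply: le_lt_trans yx.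
  by rewrite euclid_normZ ger0_norm// ler_piMl// euclid_norm_ge0.
have Ov t (t01 : 0 <= t <= 1) := (xM _ (seg t t01)).1.
have Mv t (t01 : 0 <= t <= 1) := (xM _ (seg t t01)).2.
have yE : y = x + (y - x) by rewrite addrC subrK.
split; first by rewrite yE -[y - x]scale1r; apply: Ov; rewrite lexx ler01.
- by rewrite [in leLHS]yE; exact: dX_segment.
- by rewrite [in leLHS]yE; exact: dY_segment.
Qed.

(** Consequently the Euclidean limit attached to an ideal boundary point is never in [Omega]. *)
Lemma embedX_limit (a : Xd) y : Omega y ->
  (forall e, 0 < e -> exists z, mdist a (embed Xd z) < e /\
    euclid_norm (z - y) < e) -> a = embed Xd y.
Proof.
move=> Oy ay; have [tau t0 [M M0 yM]] := local_comparison Oy.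
apply/eqP; rewrite -[_ == _]negbK -mdist_gt0; apply/negP => ay0.
have [|z [az zy]] := ay (Num.min tau (mdist a (embed Xd y) / 2)).
  by rewrite lt_min t0 divr_gt0.
move: zy az; rewrite !lt_min => /andP[/yM[_ yz _] zy] /andP[_ az].
have := metric_triangle a (embed Xd z) (embed Xd y).
have := metric_sym (embed Xd z) (embed Xd y).
lra.
Qed.

Lemma embedY_limit (p : Xr) y : Omega y ->
  (forall e, 0 < e -> exists z, mdist p (embed Xr z) < e /\
    euclid_norm (z - y) < e) -> p = embed Xr y.
Proof.
move=> Oy py; have [tau t0 [M M0 yM]] := local_comparison Oy.
apply/eqP; rewrite -[_ == _]negbK -mdist_gt0; apply/negP => py0.
set d := mdist p (embed Xr y) in py0.
have [|z [pz zy]] := py (Num.min tau (Num.min (d / 2) (d / 2 / M))).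
  by rewrite !lt_min t0 !divr_gt0.
move: zy pz; rewrite !lt_min.
move=> /andP[/yM[_ _ yz] /andP[_ zy]] /andP[_ /andP[pz _]].
move: zy; rewrite ltr_pdivlMr// mulrC => zy.
have := metric_triangle p (embed Xr z) (embed Xr y).
have := metric_sym (embed Xr z) (embed Xr y).
by rewrite -/d; lra.
Qed.

(** The internal distance dominates the Euclidean one, so the identity of [Omega] extends to the
    completion; [y] is the image of [a]. *)
Lemma euclid_shadow (a : Xd) : exists y, forall e, 0 < e -> exists z,
  [/\ Omega z, mdist a (embed Xd z) < e & euclid_norm (z - y) < e].
Proof.
have [z az] : {z : nat -> 'rV[R]_n & forall k, Omega (z k) /\
    mdist a (embed Xd (z k)) < k.+1%:R^-1}.
  apply: (@choice _ _ (fun k z => Omega z /\ mdist a (embed Xd z) < _)) => k.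
  by have [|u Du au] := @embed_near _ _ _ _ Xd a k.+1%:R^-1; [|exists u].
have zz m k : euclid_norm (z m - z k) < k.+1%:R^-1 + m.+1%:R^-1.
  apply: le_lt_trans (euclid_norm_le_dX (az k).1 (az m).1) _.
  apply: le_lt_trans (metric_triangle _ a _) _.
  by rewrite (metric_sym _ a) ltrD// (az _).2.
have [|y zy] := @row_cauchy_seq _ _ z.
  move=> e e0; have [|N eN] := @invS_lt _ (e / 2); first by rewrite divr_gt0.
  exists N => m k /eN me /eN ke.
  apply: le_lt_trans (norm_le_euclid_norm _) _; apply: lt_trans (zz m k) _.
  by rewrite [e]splitr ltrD.
exists y => e e0; have [N1 eN1] := invS_lt e0.
(* The factor n + 1 passes from the sup norm to the Euclidean norm and is positive also for n =
   0. *)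
have n0 : 0 < n%:R + 1 :> R by rewrite ltr_wpDl.
have [|N2 eN2] := zy (e / (n%:R + 1)); first by rewrite divr_gt0.
pose k := maxn N1 N2; exists (z k); split; first exact: (az k).1.
  by apply: lt_trans (az k).2 _; apply: eN1; exact: leq_maxl.
have := eN2 k (leq_maxr _ _); rewrite ltr_pdivlMr// => yk.
apply: le_lt_trans yk; rewrite mulrC.
apply: le_trans (ler_euclid_norm (normr_ge0 (y - z k)) _) _.
  by move=> j; rewrite distrC coord_le_norm.
by rewrite ler_wpM2r// lerDl.
Qed.
(** By [local_comparison] the rho-distance from [x] is continuous along the curve. This places
    points at prescribed rho-distances. *)
Lemma curve_dY_ivt x y L g (h : R) :
  is_curve Omega x y L g -> 0 <= h <= dY x y ->
  exists2 t, 0 <= t <= L & dY x (g t) = h.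
Proof.
move=> c hD; have [L0 g0 gL Og _] := c.
pose f t := dY x (g (clamp L t)).
have fL : f L = dY x y by rewrite /f clamp_id ?lexx ?L0// gL.
have f0 : f 0 = 0 by rewrite /f clamp_id ?lexx ?L0// g0 mdistxx.
have cf : continuous f.
  move=> s; have Os := Og _ (clamp_itv s L0).
  have [tau t0 [M M0 sM]] := local_comparison Os.
  apply/cvgrPdist_lt => e e0; have eM : 0 < e / M by rewrite divr_gt0.
  exists (Num.min tau (e / M)) => /=; first by rewrite lt_min t0.
  move=> t /=; rewrite lt_min distrC => /andP[st1 st2].
  have gst := curve_clamp_lip s t c.
  have [_ _ st] := sM _ (le_lt_trans gst st1).
  apply: (@le_lt_trans _ _ (dY (g (clamp L s)) (g (clamp L t)))).
    rewrite /f ler_norml.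
    move: (g (clamp L s)) (g (clamp L t)) => gs gt.
    have := metric_triangle (embed Xr x) (embed Xr gs) (embed Xr gt).
    have := metric_triangle (embed Xr x) (embed Xr gt) (embed Xr gs).
    rewrite (metric_sym (embed Xr gt) (embed Xr gs)).
    by move=> *; apply/andP; split; lra.
  apply: (le_lt_trans st); apply: (@le_lt_trans _ _ (M * `|t - s|)).
    by rewrite ler_pM2l.
  by rewrite mulrC -ltr_pdivlMr.
have [||t] := @IVT _ f 0 L h L0.
- exact: continuous_subspaceT.
- by rewrite f0 fL min_l ?max_r ?mdist_ge0.
rewrite in_itv/= => tL; rewrite /f clamp_id// => <-.
by exists t.
Qed.

End domain_metrics.

(** * The distance to the internal boundary *)

Section boundary.
Context {R : realType} {n : nat}.
Variables (Omega : set 'rV[R]_n) (rho : 'rV[R]_n -> R).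
Variables (Xd : completion Omega (inner_dist Omega)).
Variables (Xr : completion Omega (rho_dist Omega rho)).
Hypothesis open_Omega : open Omega.
Hypothesis continuous_rho : {within Omega, continuous rho}.
Hypothesis rho_gt0 : forall x, Omega x -> 0 < rho x.
Implicit Types (x y v w : 'rV[R]_n) (g : R -> 'rV[R]_n) (L : R).

Local Notation dX x y := (mdist (embed Xd x) (embed Xd y)).
Local Notation dY x y := (mdist (embed Xr x) (embed Xr y)).

Lemma boundary_dist_le x a : ideal_boundary Xd a ->
  (boundary_dist Xd x <= (mdist (embed Xd x) a)%:E)%E.
Proof. by move=> ba; apply: ereal_inf_lbound; exists a. Qed.

Lemma boundary_dist_lip x y :
  (boundary_dist Xd x <= boundary_dist Xd y + (dX x y)%:E)%E.
Proof.
rewrite -leeBlDr//; apply: le_ereal_inf_tmp => _ [a ba <-].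
rewrite leeBlDr//; apply: le_trans (boundary_dist_le x ba) _.
by rewrite -EFinD lee_fin addrC metric_triangle.
Qed.

(** An ideal boundary point too close to [x] would have its Euclidean limit in a ball around [x]
    inside [Omega], and so would be a point of [Omega]. *)
Lemma boundary_dist_gt0 x : Omega x -> (0 < boundary_dist Xd x)%E.
Proof.
move=> Ox; have [tau t0 [M M0 xM]] :=
  rho_bounded_near open_Omega continuous_rho rho_gt0 Ox.
apply: (@lt_le_trans _ _ (tau / 2)%:E); first by rewrite lte_fin divr_gt0.
apply: le_ereal_inf_tmp => _ [a ba <-]; rewrite lee_fin leNgt; apply/negP => xa.
have [y ay] := euclid_shadow a.
have Oy : Omega y.
  have [|z [Oz az zy]] := ay (tau / 4); first by rewrite divr_gt0.
  apply: (xM y _).1.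
  have := ler_distD z y x; have := norm_le_euclid_norm (z - y).
  have := le_trans (norm_le_euclid_norm _) (euclid_norm_le_dX Xd Ox Oz).
  have := metric_triangle (embed Xd x) a (embed Xd z).
  rewrite (distrC z y); lra.
apply: ba; exists y => //.
apply: esym (embedX_limit _ open_Omega continuous_rho rho_gt0 Oy _) => // e /ay.
by move=> [z [_ az zy]]; exists z.
Qed.

(* The first point where the segment leaves [Omega] would be an ideal boundary
   point at internal distance at most [euclid_norm v] of [w]. *)
Lemma boundary_dist_ball w v : Omega w ->
  ((euclid_norm v)%:E < boundary_dist Xd w)%E -> Omega (w + v).
Proof.
move=> Ow vw; apply: contrapT => nOv.
pose S := [set t : R | 0 <= t /\ ~ Omega (w + t *: v)].
have S1 : S 1 by rewrite /S/= scale1r ler01.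
have infS : has_inf S by split; [exists 1|exists 0 => t []].
pose T := inf S.
have T0 : 0 <= T by apply: lb_le_inf => [|t []]; first by exists 1.
have T1 : T <= 1 by apply: ge_inf => //; case: infS.
have segO t : 0 <= t < T -> Omega (w + t *: v).
  move=> /andP[t0 tT]; apply: contrapT => nO.
  have : T <= t by apply: ge_inf => //; case: infS.
  by rewrite leNgt tT.
have nOT : ~ Omega (w + T *: v).
  move=> OT; have [tau t0 [M M0 xM]] :=
    rho_bounded_near open_Omega continuous_rho rho_gt0 OT.
  have v1 : 0 < `|v| + 1 by rewrite ltr_wpDl.
  have [|t [t0' nOt] tT] := @inf_adherent _ S (tau / (`|v| + 1)) _ infS.
    by rewrite divr_gt0.
  have Tt : T <= t by apply: ge_inf; [case: infS|split].
  apply: nOt; apply: (xM _ _).1.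
  rewrite opprD addrACA subrr add0r -scalerBl normrZ ger0_norm ?subr_ge0//.
  have : (t - T) * (`|v| + 1) < tau by rewrite -ltr_pdivlMr// ltrBlDl.
  by apply: le_lt_trans; rewrite ler_wpM2l ?subr_ge0// lerDl.
have Tp : 0 < T.
  rewrite lt_neqAle T0 andbT; apply/eqP => T0'; apply: nOT.
  by rewrite -T0' scale0r addr0.
(* These parameters increase to the exit time [T]. Before [T] the segment stays in [Omega], so the
   points [z k] are Cauchy for the internal metric. *)
pose s (k : nat) : R := T * (1 - k.+2%:R^-1).
have k2 k : 0 < k.+2%:R^-1 :> R by rewrite invr_gt0.
have sT k : 0 <= s k < T.
  have e1 : k.+2%:R^-1 <= 1 :> R by rewrite invf_le1// ler1n.
  by rewrite /s mulr_ge0 ?subr_ge0//= gtr_pMr// gtrBl.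
pose z k := w + s k *: v.
have Oz k : Omega (z k) by exact: segO.
have zz t u : 0 <= t < T -> 0 <= u < T ->
    dX (w + t *: v) (w + u *: v) <= `|u - t| * euclid_norm v.
  move=> /andP[t0 tT] /andP[u0 uT].
  have -> : w + u *: v = w + t *: v + (u - t) *: v.
    by rewrite -addrA -scalerDl addrCA subrr addr0.
  rewrite -euclid_normZ; apply: dX_segment => // r /andP[r0 r1].
  rewrite scalerA -addrA -scalerDl; apply: segO.
  have p1 : 0 <= (1 - r) * t by rewrite mulr_ge0// subr_ge0.
  have p2 : 0 <= r * u by rewrite mulr_ge0.
  (* The parameter t + r (u - t) lies between [t] and [u], hence below [T]. *)
  have : r * (u - t) <= Num.max 0 (u - t).
    have [ut|tu] := leP 0 (u - t); first by rewrite ler_piMl.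
    by rewrite mulr_ge0_le0// ltW.
  rewrite le_max => /orP p3; apply/andP; split; first by nra.
  by case: p3; lra.
have v0 := euclid_norm_ge0 v.
have [|a za] := @completion_cauchy_seq _ _ _ _ Xd (fun k => embed Xd (z k)).
  move=> e e0.
  have e1 : 0 < e / (euclid_norm v + 1) by rewrite divr_gt0// ltr_wpDl.
  have [N eN] := invS_lt e1; exists N => m k Nm Nk.
  apply: le_lt_trans (zz _ _ (sT m) (sT k)) _.
  have : `|s k - s m| < e / (euclid_norm v + 1).
    have := eN _ (leq_trans Nm (leqnSn _)).
    have := eN _ (leq_trans Nk (leqnSn _)).
    move: (k2 m) (k2 k); rewrite /s; move: (m.+2%:R^-1) (k.+2%:R^-1) (e / _).
    by move=> p q r p0 q0 pr qr; rewrite ltr_norml; apply/andP; split; nra.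
  rewrite ltr_pdivlMr ?ltr_wpDl// => /(le_lt_trans _); apply.
  by rewrite ler_wpM2l// lerDl.
(* If [a] came from a point of [Omega], that point would be the Euclidean limit of the [z k], which
   is the exit point and lies outside. *)
have ba : ideal_boundary Xd a.
  move=> [u Ou ua]; apply: nOT; suff -> : w + T *: v = u by [].
  apply/eqP; rewrite -subr_eq0 -normr_le0; apply/ler_addgt0Pr => e e0.
  have [|N aN] := za (e / 2); first by rewrite divr_gt0.
  have e1 : 0 < e / 2 / (`|v| + 1) by rewrite !divr_gt0// ltr_wpDl.
  have [N' eN] := invS_lt e1.
  pose k := maxn N N'; have := aN k (leq_maxl _ _); rewrite -ua => uk.
  have := le_trans (norm_le_euclid_norm _) (euclid_norm_le_dX Xd Ou (Oz k)).
  have : `|w + T *: v - z k| <= e / 2.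
    rewrite /z opprD addrACA subrr add0r -scalerBl normrZ.
    have := eN k.+1 (leq_trans (leq_maxr _ _) (leqnSn _)).
    rewrite ltr_pdivlMr ?ltr_wpDl//.
    have -> : T - s k = T * k.+2%:R^-1.
      by rewrite /s mulrBr mulr1 opprB addrC subrK.
    move: (k2 k) (normr_ge0 v); move: (k.+2%:R^-1) => p p0 v1.
    rewrite ger0_norm => [pe|]; last by rewrite mulr_ge0// ltW.
    have : T * (p * `|v|) <= p * `|v| by rewrite ler_piMl// mulr_ge0// ltW.
    by lra.
  have := ler_distD (z k) (w + T *: v) u; lra.
have wa : mdist (embed Xd w) a <= euclid_norm v.
  apply/ler_addgt0Pr => e e0; have [N aN] := za e e0.
  have := metric_triangle (embed Xd w) (embed Xd (z N)) a.
  have := aN N (leqnn _); rewrite (metric_sym a).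
  have := zz 0 (s N) _ (sT N); rewrite lexx Tp scale0r addr0 subr0 => /(_ isT).
  have /andP[s0 sT'] := sT N; rewrite ger0_norm// => wz.
  have : s N * euclid_norm v <= euclid_norm v.
    by rewrite ler_piMl// (le_trans (ltW sT')).
  by rewrite /z in wz *; lra.
have := lt_le_trans vw (boundary_dist_le w ba).
by rewrite lte_fin ltNge wa.
Qed.

End boundary.

(** * The rho-diameter of small balls in a John domain *)

Lemma powR_le_nonpos (R : realType) (a u v : R) : a <= 0 -> 0 < u -> u <= v ->
  v `^ a <= u `^ a.
Proof.
move=> a0 u0 uv; have v0 := lt_le_trans u0 uv.
rewrite -[a]opprK !(powRN _ (- a)) lef_pV2 ?posrE ?powR_gt0//.
by apply: ge0_ler_powR; rewrite ?oppr_ge0// nnegrE ltW.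
Qed.

(** The cube of half-side [B] around [y] is cut into [M ^ n] cells of side [sigma]; the cell of a
    point is read off by truncating its rescaled coordinates. *)
Lemma grid_pigeonhole (R : realType) n (M N : nat) (P : 'I_N.+1 -> 'rV[R]_n)
    (y : 'rV[R]_n) (B sigma : R) : 0 < sigma -> 2 * B < M%:R * sigma ->
  (M ^ n <= N)%N -> (forall i, `|P i - y| <= B) ->
  exists i j : 'I_N.+1, (i < j)%N /\ forall k, `|(P j - P i) ord0 k| <= sigma.
Proof.
move=> s0 BM MN PB.
have M0 : (0 < M)%N.
  rewrite lt0n; apply/eqP => M0; move: BM; rewrite M0 mul0r.
  by have := le_trans (normr_ge0 _) (PB ord0); lra.
case: M M0 BM MN => // M _ BM MN.
pose coord i k := ((P i - y) ord0 k + B) / sigma.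
have PBk i k : - B <= (P i - y) ord0 k <= B.
  by rewrite -ler_norml; apply: le_trans (coord_le_norm _ k) (PB i).
have Pk i k : 0 <= coord i k.
  by apply: divr_ge0; [have := PBk i k; lra|exact: ltW].
have PM i k : coord i k < M.+1%:R.
  rewrite ltr_pdivrMr//; apply: le_lt_trans BM.
  by have := PBk i k; lra.
pose cell (i : 'I_N.+1) :=
  [ffun k : 'I_n => inord (Num.truncn (coord i k)) : 'I_M.+1].
have /injectivePn[i [j ij cij]] : ~~ injectiveb cell.
  apply/negP => /injectiveP/leq_card.
  by rewrite card_ord card_ffun !card_ord ltnNge MN.
have cellE k : Num.truncn (coord i k) = Num.truncn (coord j k).
  have tM l : (Num.truncn (coord l k) < M.+1)%N.
    by rewrite truncn_lt_nat.
  by have /ffunP/(_ k)/(congr1 val) := cij; rewrite !ffunE /= !inordK.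
have close k : `|(P j - P i) ord0 k| <= sigma.
  have -> : (P j - P i) ord0 k = (coord j k - coord i k) * sigma.
    by rewrite /coord mulrBl !divfK ?gt_eqF// !mxE; lra.
  rewrite normrM (gtr0_norm s0); apply: ler_piMl; first exact: ltW.
  rewrite ler_norml.
  have /andP[i1 i2] := truncn_itv (Pk i k).
  have /andP[j1 j2] := truncn_itv (Pk j k).
  move: i1 i2 j1 j2; rewrite cellE -[(_.+1)%:R]natr1.
  by move: (_%:R) => t; lra.
have [ltij|ltji|/val_inj eij] := ltngtP i j.
- by exists i, j.
- by exists j, i; split => // k; rewrite -opprB mxE normrN.
- by rewrite eij eqxx in ij.
Qed.

Section john_upper_bound.
Context {R : realType} {n : nat}.
Variables (Omega : set 'rV[R]_n) (rho : 'rV[R]_n -> R).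
Variables (Xd : completion Omega (inner_dist Omega)).
Variables (Xr : completion Omega (rho_dist Omega rho)).
Hypothesis open_Omega : open Omega.
Hypothesis continuous_rho : {within Omega, continuous rho}.
Hypothesis rho_gt0 : forall x, Omega x -> 0 < rho x.
Variables (b : Xd) (bdb : ideal_boundary Xd b).
Implicit Types (x y z v w : 'rV[R]_n) (g : R -> 'rV[R]_n) (L : R).

Local Notation dX x y := (mdist (embed Xd x) (embed Xd y)).
Local Notation dY x y := (mdist (embed Xr x) (embed Xr y)).
Local Notation delta x := (fine (boundary_dist Xd x)).

(** The boundary point [b] makes the infimum finite, so [fine] loses nothing. *)
Lemma boundary_dist_fin x : ((delta x)%:E = boundary_dist Xd x)%E.
Proof.
rewrite fineK// ge0_fin_numE.
  exact: le_lt_trans (boundary_dist_le x bdb) (ltry _).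
by apply: le_ereal_inf_tmp => _ [a _ <-]; rewrite lee_fin mdist_ge0.
Qed.

Lemma delta_gt0 x : Omega x -> 0 < delta x.
Proof.
by move=> Ox; rewrite -lte_fin boundary_dist_fin (boundary_dist_gt0 Xd Xr).
Qed.

Lemma delta_le x a : ideal_boundary Xd a -> delta x <= mdist (embed Xd x) a.
Proof. by move=> ba; rewrite -lee_fin boundary_dist_fin boundary_dist_le. Qed.

Lemma delta_lip x y : delta x <= delta y + dX x y.
Proof. by rewrite -lee_fin EFinD !boundary_dist_fin boundary_dist_lip. Qed.

Lemma delta_ball w v : Omega w -> euclid_norm v < delta w -> Omega (w + v).
Proof.
rewrite -lte_fin boundary_dist_fin.
exact: (boundary_dist_ball open_Omega continuous_rho).
Qed.

Lemma delta_segment w v s : Omega w -> euclid_norm v < delta w ->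
  0 <= s <= 1 -> [/\ Omega (w + s *: v), dX w (w + s *: v) <= euclid_norm v &
    delta w - euclid_norm v <= delta (w + s *: v)].
Proof.
move=> Ow vw.
have le_v u : 0 <= u <= 1 -> euclid_norm (u *: v) <= euclid_norm v.
  move=> /andP[u0 u1]; rewrite euclid_normZ ger0_norm//.
  by rewrite ler_piMl ?euclid_norm_ge0.
have Os u : 0 <= u <= 1 -> Omega (w + u *: v).
  by move=> /le_v uv; apply: delta_ball => //; exact: le_lt_trans vw.
move=> s01; have ws : dX w (w + s *: v) <= euclid_norm v.
  apply: le_trans (le_v _ s01); apply: dX_segment => u u01.
  rewrite scalerA; apply: Os; move: s01 u01 => /andP[? ?] /andP[? ?].
  by rewrite mulr_ge0//= mulr_ile1.
split; [exact: Os|by []|].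
by rewrite lerBlDr (le_trans (delta_lip w (w + s *: v)))// lerD2l.
Qed.

Variables (alpha : R) (x0 : 'rV[R]_n).
Hypothesis alpha01 : 0 < alpha <= 1.
Hypothesis john : forall x, Omega x -> exists L g, is_curve Omega x x0 L g /\
  forall t, 0 <= t <= L -> ((alpha * t)%:E <= boundary_dist Xd (g t))%E.
Variables (a d0 : R).
Hypothesis a01 : -1 < a <= 0.
Hypothesis rho_le : forall y, Omega y -> mdist b (embed Xd y) < d0 ->
  rho y <= delta y `^ a.

(** The factor (alpha / 3)^a comes from delta >= (alpha / 3) * (t + delta z) along the John curve,
    the rest from integrating (t + delta z)^a, where t + delta z <= r + 3 r. *)
Let C1 := (alpha / 3) `^ a * ((1 + a)^-1 * 4 `^ (1 + a)).

(* The John curve of [z] followed up to length [r]: since the distance to the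
   boundary is at least comparable to t + delta z along it, its rho-length is
   controlled by the integral of (t + delta z)^a, which converges as a > -1. *)
Lemma john_flow z r : Omega z -> mdist b (embed Xd z) < 3 * r ->
  0 < r -> 5 * r <= d0 -> 5 * r <= delta x0 ->
  exists w, [/\ Omega w, dX z w <= r, alpha * r <= delta w &
    dY z w <= C1 * r `^ (1 + a)].
Proof.
move=> Oz bz r0 rd rx; have [L [g [c jg]]] := john Oz.
have [L0 g0 gL Og _] := c.
have /andP[al0 al1] := alpha01; have /andP[a1 a0] := a01.
(* A shorter John curve would put [x0] within 4 r of [b], against 5 r <= delta x0. *)
have rL : r <= L.
  rewrite leNgt; apply/negP => Lr.
  have := dX_le_curve Xd c (t := L); rewrite L0 lexx gL => /(_ isT).
  have := delta_le x0 bdb; have := metric_triangle (embed Xd x0) (embed Xd z) b.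
  rewrite (metric_sym (embed Xd x0) (embed Xd z)).
  rewrite (metric_sym (embed Xd z) b); lra.
have c' : is_curve Omega z (g r) r g.
  by apply: (is_curve_sub c); rewrite (ltW r0).
exists (g r); split.
- by apply: Og; rewrite (ltW r0).
- by apply: (dX_le_curve Xd c); rewrite (ltW r0).
- by rewrite -lee_fin boundary_dist_fin; apply: jg; rewrite (ltW r0).
have dz0 := delta_gt0 Oz.
have dzr : delta z < 3 * r.
  by apply: le_lt_trans (delta_le z bdb) _; rewrite metric_sym.
have al3 : 0 < alpha / 3 by rewrite divr_gt0.
have Or : 0 <= r by exact: ltW.
rewrite -lee_fin embed_isometry//; last by apply: Og; rewrite Or.
apply: le_trans (rho_dist_le rho c') _.
apply: le_trans (@rho_length_powR _ _ _ _ open_Omega continuous_rho rho_gt0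
  _ _ _ _ a (delta z) ((alpha / 3) `^ a) c' a1 dz0 (powR_ge0 _ _) _) _.
  move=> t /andP[t0 tr]; have tL : 0 <= t <= L by rewrite t0 (le_trans tr).
  have zt := dX_le_curve Xd c tL.
  have tz : 0 < t + delta z by rewrite ltr_wpDl.
  apply: (le_trans (rho_le (Og _ tL) _)).
    have := metric_triangle b (embed Xd z) (embed Xd (g t)); lra.
  rewrite -powRM; [|exact: ltW|exact: ltW].
  apply: powR_le_nonpos => //; first by rewrite mulr_gt0.
  have := delta_lip z (g t); rewrite /= => lip.
  have : alpha * t <= delta (g t).
    by rewrite -lee_fin boundary_dist_fin; exact: jg.
  (* For t <= delta z / 2 the Lipschitz bound gives delta (g t) >= delta z / 2 >= (t + delta z) / 3;
     for larger [t] one has t + delta z < 3 t and the John condition applies. *)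
  move=> /= jt; have [tdz|tdz] := leP t (delta z / 2).
    have : alpha * (t + delta z) <= t + delta z by rewrite ler_piMl// ltW.
    lra.
  have : alpha * (t + delta z) <= alpha * (3 * t).
    by rewrite ler_pM2l//; lra.
  lra.
rewrite lee_fin -mulrA ler_pM2l ?powR_gt0// -mulrA.
rewrite ler_pM2l ?invr_gt0; last by lra.
rewrite -powRM//; apply: ge0_ler_powR; rewrite ?nnegrE; lra.
Qed.

(** Along the segment delta stays at least alpha * r / 2, so the cost is at most (alpha * r / 2)^(1
    + a). *)
Lemma dY_segment_le w v r : Omega w -> mdist b (embed Xd w) < 4 * r ->
  0 < r -> 5 * r <= d0 -> alpha * r <= delta w ->
  euclid_norm v <= alpha * r / 2 -> dY w (w + v) <= r `^ (1 + a).
Proof.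
move=> Ow bw r0 rd dw vr; have /andP[al0 al1] := alpha01.
have /andP[a1 a0] := a01.
have ar0 : 0 < alpha * r by rewrite mulr_gt0.
have ar2 : 0 < alpha * r / 2 by rewrite divr_gt0.
have vw : euclid_norm v < delta w by lra.
have seg s s01 := delta_segment (s := s) Ow vw s01.
apply: (@le_trans _ _ ((alpha * r / 2) `^ a * euclid_norm v)).
  apply: dY_segment => // s s01; have [Os ws ds] := seg s s01; first by [].
  apply: (le_trans (rho_le Os _)).
    have := metric_triangle b (embed Xd w) (embed Xd (w + s *: v)).
    have : alpha * r <= r by rewrite ler_piMl// ltW.
    lra.
  by apply: powR_le_nonpos => //; move: ds => /=; lra.
apply: (@le_trans _ _ ((alpha * r / 2) `^ a * (alpha * r / 2))).
  by rewrite ler_pM2l// powR_gt0.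
rewrite -[X in _ * X]powRr1 ?(ltW ar2)// -powRD; last first.
  by rewrite (gt_eqF ar2) implybT.
rewrite addrC; apply: ge0_ler_powR; rewrite ?nnegrE; try by lra.
have : alpha * r <= r by rewrite ler_piMl// ltW.
lra.
Qed.

(** Cells have side alpha * r / (2 (n + 1)), so that two points of one cell are within alpha * r / 2
    in Euclidean norm. More than 12 (n + 1) / alpha of them cover an edge of length 6 r, and [N]
    counts the cells. *)
Let M := (Num.truncn (12 * (n%:R + 1) / alpha)).+1.
Let N := (M ^ n)%N.
Let C := 4 * (C1 + 1) * N%:R.

(* If dY y y' exceeded 4 K N, the intermediate value theorem would give N + 1
   points at rho-distances 0, 4 K, ..., 4 K N from y on a short curve from y to
   y'.  Two of them flow to the same grid cell, hence are at rho-distance less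
   than 4 K. *)
Lemma john_upper y y' r : Omega y -> Omega y' ->
  mdist b (embed Xd y) < r -> mdist b (embed Xd y') < r ->
  0 < r -> 5 * r <= d0 -> 5 * r <= delta x0 -> dY y y' <= C * r `^ (1 + a).
Proof.
move=> Oy Oy' by_ by'_ r0 rd rx.
have /andP[al0 al1] := alpha01; have /andP[a1 a0] := a01.
have C10 : 0 <= C1.
  by rewrite !mulr_ge0 ?powR_ge0// invr_ge0; lra.
pose P := r `^ (1 + a); have P0 : 0 < P by rewrite powR_gt0.
pose K := (C1 + 1) * P; have K0 : 0 < K by rewrite mulr_gt0// ltr_wpDl.
have CE : C * P = 4 * K * N%:R by rewrite /C /K; ring.
rewrite -/P CE leNgt; apply/negP => DK.
(* A curve of length below 2 r that starts within r of [b] stays within 3 r of it, as [john_flow]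
   requires. *)
have yy' : dX y y' < 2 * r.
  have := metric_triangle (embed Xd y) b (embed Xd y').
  rewrite (metric_sym (embed Xd y) b); lra.
have [L [g [c L2]]] := dX_curve_lt Oy Oy' yy'.
have [L0 g0 gL Og _] := c.
have [w tw] : {w : 'I_N.+1 -> 'rV[R]_n & forall j : 'I_N.+1, exists t : R,
    [/\ 0 <= t <= L, dY y (g t) = 4 * K * j%:R & [/\ Omega (w j),
      dX (g t) (w j) <= r, alpha * r <= delta (w j) &
      dY (g t) (w j) <= C1 * P]]}.
  apply: (@choice _ _ (fun (j : 'I_N.+1) w => exists t : R, [/\ 0 <= t <= L,
    dY y (g t) = 4 * K * j%:R & [/\ Omega w, dX (g t) w <= r,
    alpha * r <= delta w & dY (g t) w <= C1 * P]])) => j.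
  have [|t tL tj] := curve_dY_ivt Xd (Xr := Xr)
    open_Omega continuous_rho rho_gt0 c (h := 4 * K * j%:R).
    have K4 : 0 <= 4 * K by rewrite mulr_ge0// ltW.
    rewrite mulr_ge0//=; apply: (le_trans _ (ltW DK)).
    by rewrite ler_wpM2l// ler_nat -ltnS ltn_ord.
  have bgt : mdist b (embed Xd (g t)) < 3 * r.
    have := metric_triangle b (embed Xd y) (embed Xd (g t)).
    by have := dX_le_curve Xd c tL; have /andP[_ tL'] := tL; lra.
  have [w [Ow gw dw Yw]] := john_flow (Og _ tL) bgt r0 rd rx.
  by exists w, t.
have wy j : mdist (embed Xd y) (embed Xd (w j)) < 3 * r.
  have [t [tL _ [Ow gw _ _]]] := tw j.
  have := metric_triangle (embed Xd y) (embed Xd (g t)) (embed Xd (w j)).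
  by have := dX_le_curve Xd c tL; have /andP[_ tL'] := tL; lra.
have n1 : 0 < n%:R + 1 :> R by rewrite ltr_wpDl.
pose sigma := alpha * r / (2 * (n%:R + 1)).
have s0 : 0 < sigma by rewrite divr_gt0 ?mulr_gt0.
have [|j|i [j [ij cell]]] :=
    @grid_pigeonhole _ _ M N w y (3 * r) sigma s0 _ (leqnn _).
- have : 12 * (n%:R + 1) / alpha < M%:R by exact: truncnS_gt.
  rewrite ltr_pdivrMr// /sigma => aM.
  rewrite mulrA ltr_pdivlMr ?mulr_gt0//.
  have : 12 * (n%:R + 1) * r < M%:R * alpha * r by rewrite ltr_pM2r.
  lra.
- have [t [_ _ [Ow _ _ _]]] := tw j.
  apply: le_trans (norm_le_euclid_norm _) _.
  exact: le_trans (euclid_norm_le_dX Xd Oy Ow) (ltW (wy j)).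
have [ti [tiL yi [Owi giw dwi Ywi]]] := tw i.
have [tj [tjL yj [Owj gjw dwj Ywj]]] := tw j.
have wij : dY (w i) (w j) <= P.
  have -> : w j = w i + (w j - w i) by rewrite addrC subrK.
  apply: dY_segment_le => //.
    have := metric_triangle b (embed Xd y) (embed Xd (w i)).
    by have := wy i; lra.
  apply: le_trans (ler_euclid_norm (ltW s0) cell) _.
  rewrite /sigma mulrA ler_pdivrMr ?mulr_gt0//.
  have : 0 < alpha * r by rewrite mulr_gt0.
  lra.
have ij1 : i%:R + 1 <= j%:R :> R by rewrite natr1 ler_nat.
have : 4 * K * (i%:R + 1) <= 4 * K * j%:R by rewrite ler_pM2l// mulr_gt0.
(* The points at [ti] and [tj] are at least 4 K apart, but the way through [w i] and [w j] costs at
   most 2 C1 P + P < 4 K. *)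
rewrite -yj mulrDr -yi.
have := metric_triangle (embed Xr y) (embed Xr (g ti)) (embed Xr (g tj)).
have := metric_triangle (embed Xr (g ti)) (embed Xr (w i)) (embed Xr (g tj)).
have := metric_triangle (embed Xr (w i)) (embed Xr (w j)) (embed Xr (g tj)).
rewrite (metric_sym (embed Xr (w j)) (embed Xr (g tj))).
have : 0 <= C1 * P by rewrite mulr_ge0// ltW.
by rewrite /K; lra.
Qed.

End john_upper_bound.

(** * The identification of the two boundaries *)

Lemma large_nat (R : realType) (A e : R) : 0 < e ->
  exists k : nat, A <= k.+1%:R /\ k.+1%:R^-1 <= e.
Proof.
move=> e0; have [N eN] := invS_lt e0.
exists (maxn N (Num.truncn A)); split; last exact/ltW/eN/leq_maxl.
apply: (le_trans (ltW (truncnS_gt _))).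
by rewrite ler_nat ltnS leq_maxr.
Qed.

Lemma powR_small (R : realType) (A q e : R) : 0 <= A -> 0 < q -> 0 < e ->
  exists2 r, 0 < r & forall t, 0 <= t <= r -> A * t `^ q < e.
Proof.
move=> A0 q0 e0; have eA : 0 < e / (A + 1) by rewrite divr_gt0// ltr_wpDl.
exists ((e / (A + 1)) `^ q^-1); first exact: powR_gt0.
move=> t /andP[t0 tr].
have : t `^ q <= e / (A + 1).
  have -> : e / (A + 1) = ((e / (A + 1)) `^ q^-1) `^ q.
    by rewrite -powRrM mulVf ?gt_eqF// powRr1// ltW.
  by apply: ge0_ler_powR; rewrite ?nnegrE ?powR_ge0// ltW.
rewrite ler_pdivlMr ?ltr_wpDl//.
have [->|tn0] := eqVneq (t `^ q) 0; first by rewrite mulr0.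
have : 0 < t `^ q by rewrite lt_neqAle eq_sym tn0 powR_ge0.
lra.
Qed.

Section correspondence.
Context {R : realType} {n : nat}.
Variables (Omega : set 'rV[R]_n) (rho : 'rV[R]_n -> R).
Variables (Xd : completion Omega (inner_dist Omega)).
Variables (Xr : completion Omega (rho_dist Omega rho)).
Variable c : R.
Hypothesis open_Omega : open Omega.
Hypothesis continuous_rho : {within Omega, continuous rho}.
Hypothesis rho_gt0 : forall x, Omega x -> 0 < rho x.
Hypothesis c_gt0 : 0 < c.
Hypothesis rho_gtc : forall x, Omega x -> c < rho x.
Implicit Types (u v : 'rV[R]_n) (x : Xd) (p : Xr).

Local Notation dX x y := (mdist (embed Xd x) (embed Xd y)).
Local Notation dY x y := (mdist (embed Xr x) (embed Xr y)).
Local Notation delta x := (fine (boundary_dist Xd x)).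

(** A curve from [u] to [v] is at least [r] long, and its first piece of length [r] stays where
    [rho >= m]. *)
Lemma dY_ge u v (m r : R) : Omega u -> Omega v -> 0 <= m ->
  0 <= r <= dX u v ->
  (forall w, Omega w -> dX u w <= r -> m <= rho w) -> m * r <= dY u v.
Proof.
move=> Ou Ov m0 /andP[r0 rd] mr; rewrite -lee_fin embed_isometry//.
apply: le_ereal_inf_tmp => _ [L [g [cg ->]]].
have [L0 g0 gL Og _] := cg.
have rL : r <= L.
  by rewrite (le_trans rd)// -gL (dX_le_curve Xd cg)// L0 lexx.
apply: (rho_length_ge open_Omega continuous_rho rho_gt0 cg) => //.
  by rewrite r0.
move=> t /andP[t0 tr]; have tL : 0 <= t <= L by rewrite t0 (le_trans tr).
by apply: mr; [exact: Og|rewrite (le_trans (dX_le_curve Xd cg tL))].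
Qed.

Lemma dX_le_dY u v : Omega u -> Omega v -> c * dX u v <= dY u v.
Proof.
move=> Ou Ov; apply: dY_ge => //; first exact: ltW.
  by rewrite mdist_ge0 lexx.
by move=> w Ow _; rewrite ltW// rho_gtc.
Qed.

Section boundary_point.
Variables (x : Xd) (bx : ideal_boundary Xd x) (ix : R).
Hypothesis limit_ix :
  ln (rho y) / ln (delta y) @[y --> approach Xd x] --> ix.

(** With [d0 <= 1] one gets delta u < 1, so [ln (delta u)] is negative and clearing this denominator
    reverses inequalities. *)
Lemma limit_near (P : set R) : nbhs ix P -> exists2 d0, 0 < d0 <= 1 &
  forall u, Omega u -> mdist x (embed Xd u) < d0 ->
    [/\ 0 < delta u, delta u < 1 & P (ln (rho u) / ln (delta u))].
Proof.
move=> /limit_ix[V /nbhs_ballP[e /= e0 eV] VP].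
exists (Num.min e 1); first by rewrite lt_min e0 ltr01 ge_min lexx orbT.
move=> u Ou; rewrite lt_min => /andP[xe x1]; split.
- exact: (delta_gt0 Xr open_Omega continuous_rho rho_gt0 bx).
- by rewrite (le_lt_trans (delta_le bx u bx))// metric_sym.
- by apply: VP; split => //; apply: eV; rewrite ballEmdist.
Qed.

Lemma rho_le_powR a : a < ix -> exists2 d0, 0 < d0 <= 1 &
  forall u, Omega u -> mdist x (embed Xd u) < d0 -> rho u <= delta u `^ a.
Proof.
move=> ai; have [|d0 d01 near0] := @limit_near [set r | a < r].
  exact: lt_nbhsr.
exists d0 => // u Ou xu; have [du0 du1 /=] := near0 u Ou xu.
have lnd : ln (delta u) < 0 by rewrite -ln1 ltr_ln ?posrE.
rewrite ltr_ndivlMr// => /ltW; rewrite -ln_powR ler_ln ?posrE//.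
  exact: rho_gt0.
exact: powR_gt0.
Qed.

Lemma powR_le_rho a : ix < a -> exists2 d0, 0 < d0 <= 1 &
  forall u, Omega u -> mdist x (embed Xd u) < d0 -> delta u `^ a <= rho u.
Proof.
move=> ai; have [|d0 d01 near0] := @limit_near [set r | r < a].
  exact: lt_nbhsl.
exists d0 => // u Ou xu; have [du0 du1 /=] := near0 u Ou xu.
have lnd : ln (delta u) < 0 by rewrite -ln1 ltr_ln ?posrE.
rewrite ltr_ndivrMr// => /ltW; rewrite -ln_powR ler_ln ?posrE//.
  exact: powR_gt0.
exact: rho_gt0.
Qed.

(** A positive limit would give rho <= delta^(ix / 2) near the point, and the right-hand side falls
    below [c]. *)
Lemma exponent_le0 : ix <= 0.
Proof.
rewrite leNgt; apply/negP => i0.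
have [|d0 /andP[d00 _] le_pow] := @rho_le_powR (ix / 2); first by lra.
have i2 : 0 < ix / 2 by rewrite divr_gt0.
have [|u Ou] := @embed_near _ _ _ _ Xd x (Num.min d0 (c `^ (ix / 2)^-1)).
  by rewrite lt_min d00 powR_gt0.
rewrite lt_min => /andP[/(le_pow _ Ou) le_pow_u xu].
have du0 := delta_gt0 Xr open_Omega continuous_rho rho_gt0 bx Ou.
have du : delta u <= c `^ (ix / 2)^-1.
  by rewrite (le_trans (delta_le bx u bx))// metric_sym ltW.
have : delta u `^ (ix / 2) <= c.
  have -> : c = (c `^ (ix / 2)^-1) `^ (ix / 2).
    by rewrite -powRrM mulVf ?gt_eqF// powRr1// ltW.
  by apply: ge0_ler_powR => //; rewrite ?nnegrE ?powR_ge0 ?ltW.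
have := rho_gtc Ou; lra.
Qed.

End boundary_point.

(* The index [k] bounds both the constant and the inverse scale, so that
   countably many of these sets cover the boundary. *)
Definition upper_regular (q : R) (k : nat) : set Xd :=
  [set x | ideal_boundary Xd x /\ forall r u v, 0 < r <= k.+1%:R^-1 ->
    Omega u -> Omega v -> mdist x (embed Xd u) < r ->
    mdist x (embed Xd v) < r -> dY u v <= k.+1%:R * r `^ q].

(** Only [u] must be near [x]: a curve leaving [u] already pays on its first piece of length [r],
    wherever [v] is. *)
Definition lower_regular (q : R) (k : nat) : set Xd :=
  [set x | ideal_boundary Xd x /\ forall r u v, 0 < r <= k.+1%:R^-1 ->
    Omega u -> Omega v -> mdist x (embed Xd u) < r ->
    r <= dX u v -> r `^ q <= k.+1%:R * dY u v].

(** This is [john_upper] with a = q - 1, which is at most 0 by [exponent_le0]; [k] absorbs its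
    constant and its range of radii. *)
Lemma upper_regular_cover (alpha : R) x (ix q : R) :
  0 < alpha <= 1 -> alpha_john Xd alpha -> ideal_boundary Xd x ->
  (ln (rho y) / ln (delta y) @[y --> approach Xd x] --> ix) ->
  0 < q < 1 + ix -> exists k, upper_regular q k x.
Proof.
move=> al01 [x0 Ox0 john] bx limx /andP[q0 qi].
have ix0 := exponent_le0 bx limx.
have [|d0 /andP[d00 _] rhod] := rho_le_powR bx limx (a := q - 1); first lra.
have a01 : -1 < q - 1 <= 0 by apply/andP; split; lra.
have up u v r (Ou : Omega u) (Ov : Omega v) := @john_upper _ _ _ _ Xd Xr
  open_Omega continuous_rho rho_gt0 x bx alpha x0 al01 john (q - 1) d0
  a01 rhod u v r Ou Ov.
move: up; set C := _ * _ * _ => up.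
have dx0 := delta_gt0 Xr open_Omega continuous_rho rho_gt0 bx Ox0.
have [|k [Ck ke]] := @large_nat _ C (Num.min d0 (delta x0) / 5).
  by rewrite divr_gt0// lt_min d00.
exists k; split=> // r u v /andP[r0 rk] Ou Ov xu xv.
have : 5 * r <= Num.min d0 (delta x0).
  by rewrite mulrC -ler_pdivlMr// (le_trans rk).
rewrite le_min => /andP[rd rx].
apply: (le_trans (up u v r Ou Ov xu xv r0 rd rx)).
rewrite (addrCA 1) subrr addr0.
by rewrite ler_wpM2r// powR_ge0.
Qed.

(** For q >= 1 the Lipschitz bound from [rho > c] suffices, as r^q <= r. For q < 1 the exponent q -
    1 is negative, so delta <= 2 r gives rho >= (2 r)^(q - 1) within 2 r of [x], whence the constant
    2^(1 - q). *)
Lemma lower_regular_cover x (ix q : R) : ideal_boundary Xd x ->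
  (ln (rho y) / ln (delta y) @[y --> approach Xd x] --> ix) ->
  1 + ix < q -> exists k, lower_regular q k x.
Proof.
move=> bx limx iq; have [q1|q1] := leP 1 q.
  have [k [ck k1]] := @large_nat _ c^-1 1 ltr01.
  exists k; split=> // r u v /andP[r0 rk] Ou Ov _ ruv.
  have rr : r `^ q <= r by rewrite ge1r_powR// r0 (le_trans rk).
  apply: (le_trans rr); apply: (le_trans ruv).
  apply: (@le_trans _ _ (c^-1 * dY u v)).
    by rewrite ler_pdivlMl// dX_le_dY.
  by rewrite ler_wpM2r// mdist_ge0.
have [|d0 /andP[d00 _] rhod] := powR_le_rho bx limx (a := q - 1); first lra.
have [|k [ck k1]] := @large_nat _ (2 `^ (1 - q)) (d0 / 2).
  by rewrite divr_gt0.
exists k; split=> // r u v /andP[r0 rk] Ou Ov xu ruv.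
apply: (@le_trans _ _ (2 `^ (1 - q) * dY u v)); last first.
  by rewrite ler_wpM2r// mdist_ge0.
have low : (2 * r) `^ (q - 1) * r <= dY u v.
  apply: dY_ge => //; [exact: powR_ge0|by rewrite (ltW r0)|].
  move=> w Ow uw.
  have xw : mdist x (embed Xd w) < 2 * r.
    have := metric_triangle x (embed Xd u) (embed Xd w); lra.
  have dw0 := delta_gt0 Xr open_Omega continuous_rho rho_gt0 bx Ow.
  apply: (le_trans (powR_le_nonpos _ dw0 _)) (rhod w Ow _).
  - by lra.
  - by rewrite (le_trans (delta_le bx w bx))// metric_sym ltW.
  - by rewrite (lt_le_trans xw)// mulrC -ler_pdivlMr// (le_trans rk).
apply: (@le_trans _ _ (2 `^ (1 - q) * ((2 * r) `^ (q - 1) * r))); last first.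
  by rewrite ler_pM2l// powR_gt0.
have e2 : 2 `^ (1 - q) * 2 `^ (q - 1) = 1 :> R.
  rewrite -powRD ?pnatr_eq0 ?implybT//.
  by rewrite (_ : 1 - q + (q - 1) = 0) ?powRr0//; ring.
rewrite powRM ?(ltW r0)// -mulrA mulrA e2 mul1r.
rewrite -[X in _ * X]powRr1 ?(ltW r0)// -powRD; last first.
  by rewrite (gt_eqF r0) implybT.
by rewrite subrK.
Qed.

(* The graph of the embedding of the [rho]-completion into the internal
   completion that extends the identity of [Omega]. *)
Definition corresponding p x := forall e, 0 < e -> exists u,
  [/\ Omega u, mdist p (embed Xr u) < e & mdist x (embed Xd u) < e].

Lemma corresponding_embed u : Omega u ->
  corresponding (embed Xr u) (embed Xd u).
Proof. by move=> Ou e e0; exists u; rewrite !mdistxx. Qed.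

(** The estimate passes to the completion through approximants in [Omega]. The point [x'] is
    arbitrary, which packings need. *)
Lemma upper_regular_bound q k x x' p p' r : upper_regular q k x ->
  corresponding p x -> corresponding p' x' -> 0 < r <= k.+1%:R^-1 ->
  mdist x x' < r -> mdist p p' <= k.+1%:R * r `^ q.
Proof.
move=> [bx up] px px' r01 xr.
have /andP[r0 _] := r01.
apply/ler_addgt0Pr => e e0.
have [|u [Ou pu xu]] := px (Num.min r (e / 2)).
  by rewrite lt_min r0 divr_gt0.
have [|v [Ov pv xv]] := px' (Num.min (r - mdist x x') (e / 2)).
  by rewrite lt_min subr_gt0 xr divr_gt0.
move: pu xu pv xv; rewrite !lt_min.
move=> /andP[_ pu] /andP[xu _] /andP[_ pv] /andP[xv _].
have xv' : mdist x (embed Xd v) < r.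
  have := metric_triangle x x' (embed Xd v); lra.
have := up r u v r01 Ou Ov xu xv'.
have := metric_triangle p (embed Xr u) p'.
have := metric_triangle (embed Xr u) (embed Xr v) p'.
rewrite (metric_sym (embed Xr v) p').
move: (_ * _ `^ _) => K; lra.
Qed.

Lemma lower_regular_bound q k x x' p p' r : lower_regular q k x ->
  corresponding p x -> corresponding p' x' -> 0 < r <= k.+1%:R^-1 ->
  r < mdist x x' -> r `^ q <= k.+1%:R * mdist p p'.
Proof.
move=> [bx low] px px' r01 xr.
have /andP[r0 _] := r01; have k0 : 0 < k.+1%:R :> R by [].
apply/ler_addgt0Pr => e e0.
(* The three bounds keep [u] within [r] of [x], keep [u] and [v] at least [r] apart, and limit the
   error in rho-distance to e / k.+1. *)
pose e' := Num.min (Num.min r ((mdist x x' - r) / 2)) (e / k.+1%:R / 2).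
have e'0 : 0 < e' by rewrite !lt_min r0 !divr_gt0// subr_gt0.
have [u [Ou pu xu]] := px e' e'0; have [v [Ov pv xv]] := px' e' e'0.
move: pu xu pv xv; rewrite !lt_min.
move=> /andP[_ pu] /andP[/andP[xu xu'] _] /andP[_ pv] /andP[/andP[_ xv] _].
have uv : r <= dX u v.
  have := metric_triangle x (embed Xd u) x'.
  have := metric_triangle (embed Xd u) (embed Xd v) x'.
  rewrite (metric_sym (embed Xd v) x'); lra.
apply: (le_trans (low r u v r01 Ou Ov xu uv)).
have : dY u v <= mdist p p' + e / k.+1%:R.
  have := metric_triangle (embed Xr u) p (embed Xr v).
  have := metric_triangle p p' (embed Xr v).
  rewrite (metric_sym (embed Xr u) p).
  move: pu pv; move: (e / _) => f; lra.
rewrite -(ler_pM2l k0) => /le_trans; apply.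
by rewrite mulrDr mulrCA divff ?gt_eqF// mulr1.
Qed.

(** The upper bound with [x' = x] holds at every small radius, so the two points are at rho-distance
    0. *)
Lemma corresponding_inj q k x p p' : 0 < q -> upper_regular q k x ->
  corresponding p x -> corresponding p' x -> p = p'.
Proof.
move=> q0 ux px p'x; apply/eqP; rewrite -[_ == _]negbK -mdist_gt0; apply/negP.
move=> pp'; have [r r0 rP] := @powR_small _ k.+1%:R q _ (ler0n _ _) q0 pp'.
pose s := Num.min r k.+1%:R^-1.
have s0 : 0 < s by rewrite lt_min r0 invr_gt0 ltr0n.
have := @upper_regular_bound q k x x p p' s ux px p'x.
rewrite s0 ge_min lexx orbT mdistxx s0 => /(_ isT isT).
by rewrite leNgt rP// (ltW s0) ge_min lexx.
Qed.

(** By [dX_le_dY], points of [Omega] that are close for rho are close for the internal metric. *)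
Lemma corresponding_unique p x x' : corresponding p x -> corresponding p x' ->
  x = x'.
Proof.
move=> px px'; apply/eqP; rewrite -[_ == _]negbK -mdist_gt0; apply/negP => xx'.
have x4 : 0 < mdist x x' / 4 by rewrite divr_gt0.
have e0 : 0 < Num.min (mdist x x' / 4) (c * (mdist x x' / 4)).
  by rewrite lt_min x4 mulr_gt0.
have [u [Ou pu xu]] := px _ e0; have [v [Ov pv xv]] := px' _ e0.
move: pu xu pv xv; rewrite !lt_min.
move=> /andP[_ pu] /andP[xu _] /andP[_ pv] /andP[xv _].
have : c * dX u v < c * (mdist x x' / 2).
  apply: (le_lt_trans (dX_le_dY Ou Ov)).
  have := metric_triangle (embed Xr u) p (embed Xr v).
  rewrite (metric_sym (embed Xr u) p); lra.
rewrite ltr_pM2l//.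
have := metric_triangle x (embed Xd u) x'.
have := metric_triangle (embed Xd u) (embed Xd v) x'.
rewrite (metric_sym (embed Xd v) x'); lra.
Qed.

(** If [p] comes from [Omega], uniqueness identifies [x]; if [x] does, the approximants of [p]
    converge to it in the Euclidean sense and [embedY_limit] identifies [p]. *)
Lemma corresponding_ideal p x : corresponding p x ->
  ideal_boundary Xd x <-> ideal_boundary Xr p.
Proof.
move=> px; split=> [bx [u Ou up]|bp [u Ou ux]].
  apply: bx; exists u => //; apply: corresponding_unique px.
  by rewrite -up; exact: corresponding_embed.
apply: bp; exists u => //; apply: esym.
apply: (embedY_limit Xd open_Omega continuous_rho rho_gt0 Ou) => e e0.
have [v [Ov pv xv]] := px e e0; exists v; split=> //.
by apply: le_lt_trans xv; rewrite -ux euclid_norm_le_dX.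
Qed.

Lemma corresponding_exists_Xd p : exists x, corresponding p x.
Proof.
have [z pz] : {z : nat -> 'rV[R]_n & forall k, Omega (z k) /\
    mdist p (embed Xr (z k)) < k.+1%:R^-1}.
  apply: (@choice _ _ (fun k z => Omega z /\ mdist p (embed Xr z) < _)) => k.
  by have [|u Du pu] := @embed_near _ _ _ _ Xr p k.+1%:R^-1; [|exists u].
have [|x xz] := @completion_cauchy_seq _ _ _ _ Xd (fun k => embed Xd (z k)).
  move=> e e0; have [|N eN] := @invS_lt _ (c * e / 2).
    by rewrite divr_gt0// mulr_gt0.
  exists N => m k /eN me /eN ke; rewrite -(ltr_pM2l c_gt0).
  apply: (le_lt_trans (dX_le_dY (pz m).1 (pz k).1)).
  apply: le_lt_trans (metric_triangle _ p _) _.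
  rewrite (metric_sym _ p) [c * e]splitr ltrD//.
    exact: lt_trans (pz m).2 me.
  exact: lt_trans (pz k).2 ke.
exists x => e e0; have [N xN] := xz e e0; have [N' eN] := invS_lt e0.
exists (z (maxn N N')); split; [exact: (pz _).1| |exact/xN/leq_maxl].
by apply: lt_trans (pz _).2 _; apply/eN/leq_maxr.
Qed.

(** Upper regularity makes a sequence of [Omega] tending to [x] Cauchy for the rho-metric. *)
Lemma corresponding_exists_Xr q k x : 0 < q -> upper_regular q k x ->
  exists p, corresponding p x.
Proof.
move=> q0 [bx up].
have [z xz] : {z : nat -> 'rV[R]_n & forall k, Omega (z k) /\
    mdist x (embed Xd (z k)) < k.+1%:R^-1}.
  apply: (@choice _ _ (fun k z => Omega z /\ mdist x (embed Xd z) < _)) => j.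
  by have [|u Du pu] := @embed_near _ _ _ _ Xd x j.+1%:R^-1; [|exists u].
have [|p pz] := @completion_cauchy_seq _ _ _ _ Xr (fun k => embed Xr (z k)).
  move=> e e0; have [r r0 rP] := @powR_small _ k.+1%:R q e (ler0n _ _) q0 e0.
  pose s := Num.min r k.+1%:R^-1.
  have s0 : 0 < s by rewrite lt_min r0 invr_gt0 ltr0n.
  have [N sN] := invS_lt s0; exists N => i j /sN si /sN sj.
  apply: (le_lt_trans (up s _ _ _ (xz i).1 (xz j).1 _ _)).
  - by rewrite s0 ge_min lexx orbT.
  - exact: lt_trans (xz i).2 si.
  - exact: lt_trans (xz j).2 sj.
  - by rewrite rP// (ltW s0) ge_min lexx.
exists p => e e0; have [N pN] := pz e e0; have [N' eN] := invS_lt e0.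
exists (z (maxn N N')); split; [exact: (xz _).1|exact/pN/leq_maxl|].
by apply: lt_trans (xz _).2 _; apply/eN/leq_maxr.
Qed.

(** The bound is used at radius 2 * mdist x x', since it asks for a strict inequality; this doubling
    gives the factor 2^q. At distance 0 there is no radius, and injectivity takes over. *)
Lemma upper_regular_holder q k : 0 < q ->
  exists C d, [/\ 0 < C, 0 < d & forall x x' p p', upper_regular q k x ->
    corresponding p x -> corresponding p' x' -> mdist x x' <= d ->
    mdist p p' <= C * mdist x x' `^ q].
Proof.
move=> q0; exists (k.+1%:R * 2 `^ q), (k.+1%:R^-1 / 2); split.
- by rewrite mulr_gt0// powR_gt0.
- by rewrite divr_gt0// invr_gt0.
move=> x x' p p' ux px px' xx'.
have [xx0|] := eqVneq (mdist x x') 0.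
  move: px'; rewrite -(mdist_positivity _ _ xx0) => px'.
  rewrite (corresponding_inj q0 ux px px') !mdistxx.
  by rewrite !mulr_ge0 ?powR_ge0.
move=> xx0; have m0 : 0 < mdist x x' by rewrite lt_neqAle eq_sym xx0 mdist_ge0.
rewrite -mulrA -powRM ?mdist_ge0//.
apply: (upper_regular_bound ux px px'); last by lra.
by rewrite mulr_gt0//= mulrC -ler_pdivlMr.
Qed.

Lemma lower_regular_holder q k : 0 < q ->
  exists C d, [/\ 0 < C, 0 < d & forall x x' p p', lower_regular q k x ->
    corresponding p x -> corresponding p' x' -> mdist p p' <= d ->
    mdist x x' <= C * mdist p p' `^ q^-1].
Proof.
move=> q0; set K : R := k.+1%:R; have K0 : 0 < K by rewrite ltr0n.
have Kq0 : 0 < K^-1 `^ q by rewrite powR_gt0// invr_gt0.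
exists (2 * K `^ q^-1), (K^-1 `^ q / (2 * K)); split.
- by rewrite mulr_gt0// powR_gt0.
- by rewrite divr_gt0// mulr_gt0.
move=> x x' p p' lx px px' pp'; rewrite leNgt; apply/negP => xx'.
have m0 : 0 < mdist x x'.
  by apply: le_lt_trans xx'; rewrite mulr_ge0 ?powR_ge0// mulr_ge0 ?powR_ge0.
(* [x] and [x'] may be farther apart than the scale 1 / K of regularity. Capping [r] there yields
   K^(-q) <= K * mdist p p', which the choice of [d] excludes. *)
pose r := Num.min (mdist x x' / 2) K^-1.
have r0 : 0 < r by rewrite lt_min divr_gt0// invr_gt0.
have rm : r <= mdist x x' / 2 by rewrite ge_min lexx.
have rx : r < mdist x x' by lra.
have rK : 0 < r <= K^-1 by rewrite r0 ge_min lexx orbT.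
have := lower_regular_bound lx px px' rK rx.
rewrite -/K leNgt => /negP; apply.
have [mK|Km] := leP (mdist x x' / 2) K^-1.
  rewrite /r min_l//.
  have -> : K * mdist p p' = ((K * mdist p p') `^ q^-1) `^ q.
    by rewrite -powRrM mulVf ?gt_eqF// powRr1// mulr_ge0 ?mdist_ge0// ltW.
  apply: gt0_ltr_powR; rewrite ?nnegrE ?powR_ge0//.
    by rewrite ltW// divr_gt0.
  by rewrite powRM ?mdist_ge0 ?(ltW K0)// ltr_pdivlMr// mulrC mulrA.
rewrite /r min_r ?(ltW Km)//.
apply: (@le_lt_trans _ _ (K^-1 `^ q / 2)); last first.
  by rewrite ltr_pdivrMr// ltr_pMr// ltr1n.
rewrite -ler_pdivlMl//; apply: (le_trans pp').
by rewrite invfM [leRHS]mulrC mulrA.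
Qed.
End correspondence.

(** Density of [D] moves the common point into [D], where it has a counterpart in the other
    completion. *)
Lemma ball_meet_embed (R : realType) T (D : set T) d (X : @completion R T D d)
    (x z : X) r r' : ball x r `&` ball z r' !=set0 ->
  exists u, [/\ D u, mdist x (embed X u) < r & mdist z (embed X u) < r'].
Proof.
rewrite !ballEmdist => -[y [/= xy zy]].
have [|u Du] :=
    @embed_near _ _ _ _ X y (Num.min (r - mdist x y) (r' - mdist z y)).
  by rewrite lt_min !subr_gt0 xy zy.
rewrite lt_min => /andP[yu1 yu2]; exists u; split=> //.
- have := metric_triangle x y (embed X u); lra.
- have := metric_triangle z y (embed X u); lra.
Qed.

Theorem theorem1p1 (R : realType) (n : nat)
    (Omega : set 'rV[R]_n) (rho : 'rV[R]_n -> R)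
    (Xd : completion Omega (inner_dist Omega))
    (Xr : completion Omega (rho_dist Omega rho))
    (i : Xd -> R)
    (HOmega : john_domain Xd)
    (Hrho : density Xd Xr)
    (Hc : exists2 c : R, 0 < c & forall x, Omega x -> c < rho x)
    (Hi : forall x, ideal_boundary Xd x ->
      ln (rho y) / ln (fine (boundary_dist Xd y)) @[y --> approach Xd x]
        --> i x)
    (Hi1 : forall x, ideal_boundary Xd x -> -1 < i x) :
  hausdorff_dim (ideal_boundary Xr) =
    ereal_sup [set (((1 + beta)^-1)%:E *
      hausdorff_dim [set x | ideal_boundary Xd x /\ (i x <= beta)%R])%E |
      beta in [set beta : R | -1 < beta]]
  /\
  packing_dim (ideal_boundary Xr) =
    ereal_sup [set (((1 + beta)^-1)%:E *
      packing_dim [set x | ideal_boundary Xd x /\ (i x <= beta)%R])%E |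
      beta in [set beta : R | -1 < beta]].
Proof.
have [[oO _ _] [alpha al01 aj]] := HOmega.
have [crho rho0 [p0 _] _ _] := Hrho.
have [c c0 rhoc] := Hc.
pose U (q : R) k : set Xd := upper_regular Xr q k.
pose L (q : R) k : set Xd := lower_regular Xr q k.
have covU x q : ideal_boundary Xd x -> 0 < q < 1 + i x -> exists k, U q k x.
  move=> bx.
  exact: (upper_regular_cover Xr oO crho rho0 c0 rhoc al01 aj bx (Hi _ bx)).
have covL x q : ideal_boundary Xd x -> 1 + i x < q -> exists k, L q k x.
  move=> bx.
  exact: (lower_regular_cover Xr oO crho rho0 c0 rhoc bx (Hi _ bx)).
(* [h] inverts the natural map on the boundary; [p0] is a dummy value elsewhere. Any positive
   exponent below 1 + i gives existence, here half of 1 + i. *)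
have [h hc] : {h : Xd -> Xr & forall x, ideal_boundary Xd x ->
    corresponding (h x) x}.
  apply: (@choice _ _ (fun x p => ideal_boundary Xd x -> corresponding p x)).
  move=> x; have [bx|nbx] := pselect (ideal_boundary Xd x); last by exists p0.
  have q0 : 0 < (1 + i x) / 2 by have := Hi1 _ bx; lra.
  have [|k Uk] := covU x ((1 + i x) / 2) bx; first by rewrite q0/=; lra.
  have [p px] := corresponding_exists_Xr q0 Uk.
  by exists p.
have hB : ideal_boundary Xr = h @` ideal_boundary Xd.
  apply/seteqP; split=> [p bp|_ [x bx <-]]; last first.
    exact: (corresponding_ideal oO crho rho0 c0 rhoc (hc _ bx)).1.
  have [x px] := corresponding_exists_Xd Xd oO crho rho0 c0 rhoc p.
  have bx := (corresponding_ideal oO crho rho0 c0 rhoc px).2 bp.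
  have q0 : 0 < (1 + i x) / 2 by have := Hi1 _ bx; lra.
  have [|k Uk] := covU x ((1 + i x) / 2) bx; first by rewrite q0/=; lra.
  exists x => //; exact: (corresponding_inj q0 Uk (hc _ bx) px).
rewrite hB; split.
- apply: (@null_dim_image R Xd Xr (fun s A => hausdorff_measure s A = 0%E)
    (fun s A => hausdorff_measure s A = 0%E) (ideal_boundary Xd) h i U L).
  + by move=> s t A; exact: hausdorff_eq0_le.
  + by move=> s t A; exact: hausdorff_eq0_le.
  + by move=> s A A'; exact: sub_hausdorff_eq0.
  + by move=> s A A'; exact: sub_hausdorff_eq0.
  + by move=> s F; exact: bigcup_hausdorff_eq0.
  + by move=> s F; exact: bigcup_hausdorff_eq0.
  + move=> q k s A q0 s0 AU A0.
    have [C [d [C0 dd0 hol]]] := upper_regular_holder Xd Xr k q0.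
    apply: (@hausdorff_eq0_image _ _ _ _ id h A C q d C0 q0 dd0);
      [|by []|by rewrite image_id].
    move=> x z Ax Az; apply: (hol _ _ _ _ (AU _ Ax)).
    * by apply: hc; case: (AU _ Ax).
    * by apply: hc; case: (AU _ Az).
  + move=> q k s A q0 s0 AL A0.
    have [C [d [C0 dd0 hol]]] := lower_regular_holder Xd Xr k q0.
    have q10 : 0 < q^-1 by rewrite invr_gt0.
    rewrite -(image_id A).
    (* The same transfer with the two spaces exchanged and exponent 1 / q. *)
    apply: (@hausdorff_eq0_image _ _ _ _ h id A C q^-1 d C0 q10 dd0);
      [|by rewrite mulr_gt0|by rewrite mulKf ?gt_eqF].
    move=> x z Ax Az; apply: (hol _ _ _ _ (AL _ Ax)).
    * by apply: hc; case: (AL _ Ax).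
    * by apply: hc; case: (AL _ Az).
  + exact: covU.
  + exact: covL.
  + exact: Hi1.
- apply: (@null_dim_image R Xd Xr (fun s A => packing_measure s A = 0%E)
    (fun s A => packing_measure s A = 0%E) (ideal_boundary Xd) h i U L).
  + by move=> s t A; exact: packing_eq0_le.
  + by move=> s t A; exact: packing_eq0_le.
  + by move=> s A A'; exact: sub_packing_eq0.
  + by move=> s A A'; exact: sub_packing_eq0.
  + by move=> s F; exact: bigcup_packing_eq0.
  + by move=> s F; exact: bigcup_packing_eq0.
  + move=> q k s A q0 s0 AU A0.
    have [C [d [C0 dd0 hol]]] := upper_regular_holder Xd Xr k q0.
    apply: (@packing_eq0_image _ _ _ _ id h A C q d C0 q0 dd0);
      [|by []|by rewrite image_id].
    move=> x z r r' Ax Az /andP[r0 rd] /andP[r0' rd'].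
    move=> /ball_meet_embed[u [Ou xu zu]]; exists (embed Xr u).
    rewrite !ballEmdist/=.
    (* The Hölder bound is applied between the regular centre [y] and the interior point [u]. *)
    have near y s' : A y -> 0 < s' <= d -> mdist y (embed Xd u) < s' ->
        mdist (h y) (embed Xr u) < C * s' `^ q.
      move=> Ay /andP[s0' sd] yu; have hy : corresponding (h y) y.
        by apply: hc; case: (AU _ Ay).
      have uu := corresponding_embed Xd Xr Ou.
      apply: le_lt_trans (hol _ _ _ _ (AU _ Ay) hy uu _) _.
        by rewrite ltW// (lt_le_trans yu).
      rewrite ltr_pM2l//; apply: gt0_ltr_powR => //.
        by rewrite nnegrE mdist_ge0.
      by rewrite nnegrE ltW.
    by split; apply: near => //; apply/andP.
  + move=> q k s A q0 s0 AL A0.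
    have [C [d [C0 dd0 hol]]] := lower_regular_holder Xd Xr k q0.
    have q10 : 0 < q^-1 by rewrite invr_gt0.
    rewrite -(image_id A).
    apply: (@packing_eq0_image _ _ _ _ h id A C q^-1 d C0 q10 dd0);
      [|by rewrite mulr_gt0|by rewrite mulKf ?gt_eqF].
    move=> x z r r' Ax Az /andP[r0 rd] /andP[r0' rd'].
    move=> /ball_meet_embed[u [Ou xu zu]]; exists (embed Xd u).
    rewrite !ballEmdist/=.
    have near y s' : A y -> 0 < s' <= d -> mdist (h y) (embed Xr u) < s' ->
        mdist y (embed Xd u) < C * s' `^ q^-1.
      move=> Ay /andP[s0' sd] yu; have hy : corresponding (h y) y.
        by apply: hc; case: (AL _ Ay).
      have uu := corresponding_embed Xd Xr Ou.
      apply: le_lt_trans (hol _ _ _ _ (AL _ Ay) hy uu _) _.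
        by rewrite ltW// (lt_le_trans yu).
      rewrite ltr_pM2l//; apply: gt0_ltr_powR => //.
        by rewrite nnegrE mdist_ge0.
      by rewrite nnegrE ltW.
    by split; apply: near => //; apply/andP.
  + exact: covU.
  + exact: covL.
  + exact: Hi1.
Qed.
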